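(* For $k\geq3$, let $F$ be a complete $k$-partite $k$-graph with $\gcd(F)=1$. Suppose that $\tau_1\leq\tau_2$ are the relative sizes of the two smallest parts of $F$. Then \begin{align*} \delta_{k-2}(\mathsf{Spa}_F)&=\max\left\{1-(1-\tau_1)^2,\ (\tau_1+\tau_2)^2\right\};\\ \delta_{k-2}(\mathsf{Div}_F)&=\begin{cases}1/4&\text{if }k=3,\\0&\text{if }k\geq4;\end{cases}\\ \delta_{k-2}(\mathsf{Cov}_F)&\leq\begin{cases}0&\text{if $F$ is a cone},\\2(\sqrt2-1)^2&\text{otherwise}.\end{cases} \end{align*}
   Context: A $k$-graph is a $k$-uniform hypergraph on a finite vertex set. It is complete $k$-partite if its vertex set is partitioned into $k$ (non-empty) parts and its edges are exactly the $k$-sets with one vertex in each part; the relative size of a part is its size divided by $|V(F)|$. An $\ell$-colouring of the vertices of a $k$-graph is proper if no edge contains more than one vertex of the same colour; $\chi(F)$ is the least $\ell$ for which $F$ has a proper $\ell$-colouring (here $\chi(F)=k$). A $k$-graph $F$ is a cone if it has a proper $k$-colouring with a singleton colour class. Let $\mathcal{D}(F)$ be the set of the integers $\big||\phi^{-1}(1)|-|\phi^{-1}(2)|\big|$ over all proper $\chi(F)$-colourings $\phi\colon V(F)\to\{1,\dots,\chi(F)\}$; $\gcd(F)$ is the greatest common divisor of $\mathcal{D}(F)\setminus\{0\}$, with $\gcd(F)=\infty$ if $\mathcal{D}(F)=\{0\}$. $\mathrm{Hom}(F;G)$ is the set of functions $V(F)\to V(G)$ mapping edges of $F$ to edges of $G$.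 A weighting $w\colon \mathrm{Hom}(F;G)\to\mathbb{R}$ is a perfect $\mathrm{Hom}(F)$-tiling of $G$ if $\sum_{\phi}w(\phi)|\phi^{-1}(v)|=1$ for every $v\in V(G)$; it is fractional (integral) if its values lie in $[0,1]$ (in $\mathbb{Z}$). $G$ is $\mathrm{Hom}(F)$-covered if for every $v\in V(G)$ there is $\phi\in\mathrm{Hom}(F;G)$ with $|\phi^{-1}(v)|=1$. $\mathsf{Spa}_F$, $\mathsf{Div}_F$, $\mathsf{Cov}_F$ denote the sets of $k$-graphs that have a perfect fractional $\mathrm{Hom}(F)$-tiling, have a perfect integral $\mathrm{Hom}(F)$-tiling, are $\mathrm{Hom}(F)$-covered, respectively. The minimum $d$-degree $\delta_d(G)$ is the largest $\ell$ such that every $d$-subset of $V(G)$ is contained in at least $\ell$ edges. For $\mathsf{X}\in\{\mathsf{Spa}_F,\mathsf{Div}_F,\mathsf{Cov}_F\}$ the threshold $\delta_d(\mathsf{X})$ is the infimum over all $\delta\in[0,1]$ such that for all $\mu>0$ and all large enough $n$ divisible by $|V(F)|$, every $n$-vertex $k$-graph $G$ with $\delta_d(G)\geq(\delta+\mu)\binom{n-d}{k-d}$ belongs to $\mathsf{X}$. *)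

(* Defs.v *)
From mathcomp Require Import classical_sets reals.
From mathcomp Require Import all_boot all_order all_algebra.

Set Implicit Arguments.
Unset Strict Implicit.
Unset Printing Implicit Defensive.

Import Order.TTheory GRing.Theory Num.Theory.

Record kgraph (k : nat) (V : finType) := KGraph {
  edges : {set {set V}};
  edges_uniform : forall e, e \in edges -> #|e| = k
}.

(* The largest l such that every d-subset lies in at least l edges.  The bound
   l <= #|edges G| is automatic as soon as there is a d-subset, i.e. d <= #|V|. *)
Definition mindeg (k : nat) (V : finType) (d : nat) (G : kgraph k V) : nat :=
  \max_(l < #|edges G|.+1 |
        [forall (S : {set V} | #|S| == d),
          l <= #|[set e in edges G | S \subset e]|]) l.

Definition complete_partite (k : nat) (V : finType) (F : kgraph k V)
    (P : {set {set V}}) : Prop :=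
  [/\ partition P [set: V],
      #|P| = k &
      edges F = [set e : {set V} | (#|e| == k) &&
                                   [forall B in P, #|e :&: B| == 1]]].

Definition two_smallest_parts (V : finType) (P : {set {set V}})
    (A B : {set V}) : Prop :=
  [/\ A \in P, B \in P, A != B, #|A| <= #|B| &
      forall C, C \in P -> C != A -> #|B| <= #|C|].

Definition rel_size (R : realType) (V : finType) (A : {set V}) : R :=
  (#|A|%:R / #|V|%:R)%R.

Definition proper_colouring (k : nat) (V : finType) (F : kgraph k V) (l : nat)
    (c : {ffun V -> 'I_l}) : bool :=
  [forall e in edges F, forall i : 'I_l, #|[set v in e | c v == i]| <= 1].

Definition colourable (k : nat) (V : finType) (F : kgraph k V) (l : nat) : bool :=
  [exists c : {ffun V -> 'I_l}, proper_colouring F c].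

Lemma ex_colourable (k : nat) (V : finType) (F : kgraph k V) :
  exists l, colourable F l.
Proof.
exists #|V|; apply/existsP; exists [ffun v => enum_rank v].
apply/forall_inP => e _; apply/forallP => i.
apply/card_le1_eqP => x y; rewrite !inE !ffunE => /andP[_ /eqP <-] /andP[_ /eqP].
by move/enum_rank_inj.
Qed.

Definition chi (k : nat) (V : finType) (F : kgraph k V) : nat :=
  ex_minn (ex_colourable F).

Definition cone (k : nat) (V : finType) (F : kgraph k V) : bool :=
  [exists c : {ffun V -> 'I_k},
    proper_colouring F c && [exists i : 'I_k, #|c @^-1: [set i]| == 1]].

(* Colours 1 and 2 are the elements 0 and 1 of 'I_l. *)
Definition colour_diff (V : finType) (l : nat) (c : {ffun V -> 'I_l}) : nat :=
  `| #|[set v | c v == 0 :> nat]| - #|[set v | c v == 1 :> nat]| |%N.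

(* The set D(F), listed possibly with repetitions. *)
Definition colour_diffs (k : nat) (V : finType) (F : kgraph k V) : seq nat :=
  [seq colour_diff c | c : {ffun V -> 'I_(chi F)} in [set c | proper_colouring F c]].

(* [None] stands for infinity. *)
Definition gcdF (k : nat) (V : finType) (F : kgraph k V) : option nat :=
  if all (pred1 0) (colour_diffs F) then None
  else Some (\big[gcdn/0]_(m <- colour_diffs F | m != 0) m).

Definition homs (k : nat) (V W : finType) (F : kgraph k V) (G : kgraph k W)
    : {set {ffun V -> W}} :=
  [set phi : {ffun V -> W} | [forall e in edges F, phi @: e \in edges G]].

(* Weightings of Hom(F;G) are given by functions on all maps V -> W, of which
   only the values on Hom(F;G) are used. *)
Definition perfect_tiling (R : realType) (k : nat) (V W : finType)
    (F : kgraph k V) (G : kgraph k W) (w : {ffun V -> W} -> R) : Prop :=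
  forall v : W,
    (\sum_(phi in homs F G) w phi * #|phi @^-1: [set v]|%:R = 1)%R.

Definition Spa (R : realType) (k : nat) (V : finType) (F : kgraph k V)
    (W : finType) (G : kgraph k W) : Prop :=
  exists w : {ffun V -> W} -> R,
    perfect_tiling F G w /\
    (forall phi, phi \in homs F G -> (0 <= w phi <= 1)%R).

Definition Div (R : realType) (k : nat) (V : finType) (F : kgraph k V)
    (W : finType) (G : kgraph k W) : Prop :=
  exists w : {ffun V -> W} -> R,
    perfect_tiling F G w /\
    (forall phi, phi \in homs F G -> w phi \is a Num.int).

Definition Cov (k : nat) (V : finType) (F : kgraph k V)
    (W : finType) (G : kgraph k W) : Prop :=
  forall v : W, exists2 phi, phi \in homs F G & #|phi @^-1: [set v]| = 1.

(* The threshold delta_d(X); m is the number of vertices of F. *)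
Definition threshold (R : realType) (k d m : nat)
    (X : forall W : finType, kgraph k W -> Prop) : R :=
  inf [set delta : R | (0 <= delta <= 1)%R /\
    forall mu : R, (0 < mu)%R ->
      exists n0 : nat, forall n : nat, n0 <= n -> m %| n ->
        forall (W : finType) (G : kgraph k W), #|W| = n ->
          ((delta + mu) * 'C(n - d, k - d)%:R <= (mindeg d G)%:R)%R ->
          X W G]%classic.

(* Main.v *)
(** Fractional tilings. By Farkas' lemma a missing tiling yields a weight y on
    V(G) whose sum is positive but which is nonpositive on every homomorphic
    image of F. Let S consist of the k - 2 vertices of largest weight and z be
    the defect of y from its value at the lowest of them, truncated at 0.
    Mapping the two smallest parts of F to the endpoints of a pair ab in the
    link graph of S, and the other parts to S, shows
    tau1 z(a) + tau2 z(b) > average of z, in both orders. Such a fractional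
    cover rounds, at no cost, to one with values 0, 1/(tau1 + tau2), 1/tau1,
    which bounds the number of pairs in the link graph by a convex function
    whose two end values are the two terms of the maximum. Conversely, let each
    edge have at least one (two) vertices in a set X slightly smaller than
    tau1 n (than (tau1 + tau2) n): the preimage of X under a homomorphism then
    contains one (two) full parts of F.

    Integral tilings. Swapping the images of two parts C, D in a homomorphism
    onto an edge realises |C| - |D| times the difference of two unit vectors;
    as gcd(F) = 1, all differences within an edge are integral combinations of
    homomorphisms, and it remains to connect any two vertices through edges. For
    k = 3 two disjoint cliques of nearly equal sizes, not divisible by |V(F)|,
    are the obstruction.

    Covers. A vertex v is covered as soon as two edges v + e and v' + e exist. If
    not, fix k - 3 further vertices: the link graph of v and the one of a vertex
    u of maximal degree in it are disjoint, and the latter avoids the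
    neighbourhood of u in the former; counting edges gives 2 (sqrt 2 - 1)^2. *)
Require Import Defs.
From mathcomp Require Import boolp classical_sets reals.
From mathcomp Require Import all_boot all_order all_algebra.
From mathcomp Require Import zify ring lra.
Import Order.TTheory GRing.Theory Num.Theory.

Set Implicit Arguments.
Unset Strict Implicit.
Unset Printing Implicit Defensive.

(** * Thresholds and link graphs *)

Lemma ex_superset_card (W : finType) (T : {set W}) (x : nat) :
  (#|T| <= x <= #|W|)%N -> exists2 S : {set W}, T \subset S & #|S| = x.
Proof.
elim: x => [|x IH] /andP[Tx xW].
  by exists T => //; apply/eqP; rewrite -leqn0.
move: Tx; rewrite leq_eqVlt => /orP[/eqP<-|Tx]; first by exists T.
have [|S TS Sx] := IH; first by rewrite -ltnS Tx ltnW.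
have /card_gt0P[w wS] : (0 < #|~: S|)%N by rewrite cardsCs setCK subn_gt0 Sx.
exists (w |: S); first exact: subset_trans TS (subsetUr _ _).
by rewrite cardsU1 Sx; move: wS; rewrite inE => ->.
Qed.

(* Ordered pairs, so that their number is twice the degree of [S]. *)
Definition link_pairs (k : nat) (W : finType) (G : kgraph k W) (S : {set W}) :
    {set W * W} :=
  [set p : W * W | p.1 |: (p.2 |: S) \in edges G].

Lemma link_pair_spec (k : nat) (W : finType) (G : kgraph k W) (S : {set W}) a b :
  #|S|.+2 = k -> (a, b) \in link_pairs G S ->
  [/\ a != b, a \notin S & b \notin S].
Proof.
move=> Sk; rewrite inE /= => /edges_uniform; rewrite !cardsU1 !inE negb_or -Sk.
by case: (a == b) => /=; case: (a \in S); case: (b \in S) => //=;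
  move=> E; exfalso; move: E; rewrite ?add0n ?add1n; lia.
Qed.

(** Every edge containing [S] has exactly two vertices outside [S] and contributes their two
    orderings. *)
Lemma card_link_pairs (k : nat) (W : finType) (G : kgraph k W) (S : {set W}) :
  #|S|.+2 = k ->
  #|link_pairs G S| = 2 * #|[set e in edges G | S \subset e]|.
Proof.
move=> Sk; rewrite mulnC -sum_nat_const -sum1_card.
rewrite (partition_big (fun p => p.1 |: (p.2 |: S))
   (mem [set e in edges G | S \subset e])) /=; last first.
  by move=> [a b]; rewrite !inE => ->; apply/subsetP => x xS; rewrite !inE xS !orbT.
apply: eq_bigr => e; rewrite inE => /andP[eG Se].
have /eqP/cards2P[a [b [ab De]]] : #|e :\: S| = 2.
  by rewrite cardsDS // (edges_uniform eG) -Sk -addn2 addKn.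
have inD x : (x \in e :\: S) = (x == a) || (x == b) by rewrite De !inE.
rewrite sum1_card; transitivity #|[set (a, b); (b, a)]|; last first.
  by rewrite cards2 xpair_eqE negb_and ab.
apply: eq_card => -[c d]; rewrite !inE !unfold_in /= !xpair_eqE.
apply/andP/idP => [[cdG /eqP cde]|].
  have [cd cS dS] : [/\ c != d, c \notin S & d \notin S].
    by apply: (@link_pair_spec k W G S).
  have := inD c; have := inD d.
  rewrite !in_setD cS dS -cde !inE !eqxx !orbT /=.
  move=> /esym dab /esym cab.
  by move: dab cab cd => /orP[] /eqP-> /orP[] /eqP->; rewrite ?eqxx ?orbT.
have eE : a |: (b |: S) = e.
  apply/setP=> x; have := inD x; rewrite !inE.
  by case: (boolP (x \in S)) => [xS _|_ /= ->]; rewrite ?orbT ?orbF // (subsetP Se).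
have eE' : b |: (a |: S) = e by rewrite -eE setUCA.
have abG : (a, b) \in link_pairs G S by rewrite inE /= eE.
have baG : (b, a) \in link_pairs G S by rewrite inE /= eE'.
by move=> /orP[] /andP[/eqP-> /eqP->]; rewrite /= ?eE ?eE'.
Qed.

Lemma mindeg_le (k : nat) (W : finType) d (G : kgraph k W) (S : {set W}) :
  #|S| = d -> mindeg d G <= #|[set e in edges G | S \subset e]|.
Proof.
move=> Sd; apply/bigmax_leqP => l /forall_inP/(_ S); apply; exact/eqP.
Qed.

Lemma le_mindeg (k : nat) (W : finType) d (G : kgraph k W) l :
  d <= #|W| ->
  (forall S : {set W}, #|S| = d -> l <= #|[set e in edges G | S \subset e]|) ->
  l <= mindeg d G.
Proof.
move=> dW degG.
have [|S _ Sd] := @ex_superset_card W set0 d; first by rewrite cards0.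
have lE : l < #|edges G|.+1.
  rewrite ltnS; apply: leq_trans (degG S Sd) _; apply: subset_leq_card.
  by apply/subsetP => e; rewrite inE => /andP[].
rewrite /mindeg; apply: (@leq_bigmax_cond _ _ (fun i : 'I__ => i : nat) (Ordinal lE)).
by apply/forall_inP => T /eqP /degG.
Qed.

Local Open Scope ring_scope.

Lemma archi_nat (R : realType) (x : R) : exists n : nat, x <= n%:R.
Proof.
by exists (Num.bound `|x|); apply/ltW/(le_lt_trans (ler_norm _))/archi_boundP.
Qed.

Lemma bin_ordered_pairs (R : realType) (n : nat) : 
  ('C(n, 2)%:R : R) * 2 = n%:R * (n%:R - 1).
Proof.
have binE : ('C(n, 2) * 2 = n * n.-1)%N.
  rewrite muln2 bin2 -[RHS]odd_double_half oddM.
  by case: n => [|n] //=; rewrite andNb.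
rewrite -natrM binE.
by case: n {binE} => [|n]; rewrite ?mul0r ?mul0n // natrM -natr1 addrK.
Qed.

(** A name for the set whose infimum is [threshold], so that membership in it can be treated by
    itself. *)
Definition forcing_degrees (R : realType) (k d m : nat)
    (X : forall W : finType, kgraph k W -> Prop) : set R :=
  [set delta : R | (0 <= delta <= 1)%R /\
    forall mu : R, (0 < mu)%R ->
      exists n0 : nat, forall n : nat, (n0 <= n)%N -> (m %| n)%N ->
        forall (W : finType) (G : kgraph k W), #|W| = n ->
          ((delta + mu) * 'C(n - d, k - d)%:R <= (mindeg d G)%:R)%R ->
          @X W G]%classic.

Section Threshold.
Variables (R : realType) (k m : nat).
Variable X : forall W : finType, kgraph k W -> Prop.
Hypothesis k2 : (2 <= k)%N.

Let forcing : set R := @forcing_degrees R k (k - 2) m (@X).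

(** Degrees are normalised by [#|W| ^ 2], for ordered pairs, in place of the binomial coefficient.
    The discrepancy is linear in [#|W|] and is absorbed by half of [mu]. *)
Lemma forcing_of_link_pairs (v : R) :
  0 <= v <= 1 ->
  (forall mu : R, 0 < mu -> exists n0 : nat, forall (W : finType) (G : kgraph k W),
     (n0 <= #|W|)%N -> (m %| #|W|)%N ->
     (forall S : {set W}, #|S|.+2 = k ->
        (v + mu) * #|W|%:R ^+ 2 <= #|link_pairs G S|%:R) -> @X W G) ->
  forcing v.
Proof.
move=> v01 H; split=> // mu mu0.
have [n0 Hn0] := H (mu / 2) ltac:(lra).
(* From [n1] on, the linear loss [(v + mu) * 2k * n] is at most [mu / 2 * n ^ 2]. *)
have [n1 Hn1] := archi_nat (2 * k%:R * (v + mu) / (mu / 2)).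
exists (maxn (maxn n0 n1) k) => n; rewrite !geq_max -andbA => /and3P[nn0 nn1 nk] mn W G Wn degG.
apply: Hn0 => //; rewrite ?Wn // => S Sk; rewrite card_link_pairs // natrM.
have Sk2 : #|S| = (k - 2)%N by lia.
have : (mindeg (k - 2) G)%:R <= #|[set e in edges G | S \subset e]|%:R :> R.
  by rewrite ler_nat mindeg_le.
move: degG; rewrite (_ : k - (k - 2) = 2)%N; last by lia.
have := bin_ordered_pairs R (n - (k - 2)).
set C := 'C(_, _)%:R; set M := (mindeg _ _)%:R; set D := #|[set e in edges G | S \subset e]|%:R.
rewrite natrB; last by lia.
rewrite natrB // => CE CM MD.
have v0 : 0 <= v by case/andP: v01.
have n1R : (v + mu) * (2 * k%:R) <= (mu / 2) * n%:R.
  have : 2 * k%:R * (v + mu) / (mu / 2) <= n%:R by apply: le_trans Hn1 _; rewrite ler_nat.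
  by rewrite ler_pdivrMr; lra.
have : (v + mu) * (C * 2) <= 2 * D by lra.
rewrite CE; apply: le_trans.
have nR : 0 <= n%:R :> R by [].
have kR : 0 <= k%:R :> R by [].
have kn : k%:R <= n%:R :> R by rewrite ler_nat.
have kR2 : 2 <= k%:R :> R by rewrite (ler_nat R 2).
have H1 : (v + mu) * (n%:R ^+ 2 - 2 * k%:R * n%:R) <=
  (v + mu) * ((n%:R - (k%:R - 2)) * (n%:R - (k%:R - 2) - 1)).
  apply: ler_wpM2l; first by lra.
  by nra.
apply: le_trans H1.
have : (v + mu) * (2 * k%:R) * n%:R <= mu / 2 * n%:R * n%:R by apply: ler_wpM2r.
by lra.
Qed.

Lemma threshold_le (v : R) : forcing v -> threshold R (k - 2) m (@X) <= v.
Proof.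
move=> fv; apply: ge_inf => //; exists 0 => x [/andP[x0 _] _]; exact: x0.
Qed.

(** If some [delta < v] were forcing, a large construction of density halfway between [delta] and
    [v] would contradict it. No error term arises, as twice the binomial coefficient is at most
    [#|W| ^ 2]. *)
Lemma threshold_eq (v : R) : forcing v ->
  (forall (delta : R), 0 <= delta < v -> forall N : nat, 
     exists (W : finType) (G : kgraph k W),
     [/\ (N <= #|W|)%N, (m %| #|W|)%N,
     (forall S : {set W}, #|S|.+2 = k ->
        delta * #|W|%:R ^+ 2 <= #|link_pairs G S|%:R) & ~ @X W G]) ->
  threshold R (k - 2) m (@X) = v.
Proof.
move=> fv H; apply/eqP; rewrite eq_le threshold_le //=; apply: lb_le_inf; first by exists v.
move=> delta [/andP[delta0 delta1] fdelta].
rewrite leNgt; apply/negP => dv.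
have [n0 Hn0] := fdelta ((v - delta) / 2) ltac:(lra).
have [|W [G [nW mW degG]]] := H (delta + (v - delta) / 2) _ (maxn n0 k); first by lra.
apply; move: nW; rewrite geq_max => /andP[nW kW].
apply: (Hn0 #|W|) => //; rewrite (_ : k - (k - 2) = 2)%N; last by lia.
set c := delta + _ in degG *.
have c0 : 0 <= c by rewrite /c; lra.
(* The minimum degree is an integer: [l] is the real bound rounded up, so [l - 1] lies strictly
   below the bound unless [l = 0]. *)
have [l Hl] : exists l : nat, [/\ c * 'C(#|W| - (k - 2), 2)%:R <= l%:R & 
   (l%:R - 1 < c * 'C(#|W| - (k - 2), 2)%:R) \/ l = 0%N].
  have [l0 Hl0] := archi_nat (c * 'C(#|W| - (k - 2), 2)%:R).
  have [l cl lmin] := find_ex_minn (ex_intro (fun l : nat => c * _ <= l%:R) l0 Hl0).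
  exists l; split=> //; case: l {cl} lmin => [|l] lmin; [by right | left].
  rewrite -natr1 addrK ltNge; apply/negP => /lmin; by rewrite ltnn.
case: Hl => cl lc; apply: le_trans cl _; rewrite ler_nat; apply: le_mindeg; first by lia.
move=> S Sk; case: lc => [lc|->//].
have Sk2 : #|S|.+2 = k by lia.
have := degG S Sk2; rewrite card_link_pairs // natrM => cD.
rewrite -ltnS -(ltr_nat R) -natr1 -ltrBlDr; apply: lt_le_trans lc _.
have := bin_ordered_pairs R (#|W| - (k - 2)).
set C := 'C(_, _)%:R; rewrite natrB; last by lia.
rewrite natrB // => CE.
have kR2 : 2 <= k%:R :> R by rewrite (ler_nat R 2).
have kn : k%:R <= #|W|%:R :> R by rewrite ler_nat.
have H1 : c * (C * 2) <= c * #|W|%:R ^+ 2 by rewrite CE; apply: ler_wpM2l => //; nra.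
lra.
Qed.

End Threshold.

(** * Perfect fractional tilings *)

(* Bartl's induction: if the constraint [a j] cannot be dropped, as witnessed by
   [x0], eliminate it by projecting along [x0] onto its kernel. *)
Lemma farkas (R : realType) (W : finType) (I : eqType) (r : seq I)
    (a : I -> W -> R) (c : W -> R) :
  uniq r ->
  (forall y : W -> R, (forall i, i \in r -> \sum_v y v * a i v <= 0) ->
    \sum_v y v * c v <= 0) ->
  exists2 w : I -> R, (forall i, 0 <= w i) &
    forall v, c v = \sum_(i <- r) w i * a i v.
Proof.
elim: r a c => [|j r IH] a c /= => [_ | /andP[jr ur]] H.
  exists (fun=> 0) => // v; rewrite big_nil.
  (* Without constraints [y = c] is admissible, so the sum of the squares of [c] is nonpositive. *)
  have : \sum_u c u * c u == 0.
    by rewrite eq_le H //= sumr_ge0 // => u _; rewrite -expr2 sqr_ge0.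
  rewrite psumr_eq0 => [/allP/(_ v)|u _]; last by rewrite -expr2 sqr_ge0.
  by rewrite mem_index_enum mulf_eq0 orbb => /(_ isT)/eqP.
have [H1|/existsNP[x0]] := pselect (forall y : W -> R,
    (forall i, i \in r -> \sum_v y v * a i v <= 0) -> \sum_v y v * c v <= 0).
  have [w w0 wc] := IH a c ur H1; exists (fun i => if i == j then 0 else w i).
    by move=> i; case: ifP.
  move=> v; rewrite big_cons eqxx mul0r add0r wc; apply: eq_big_seq => i ir.
  by case: eqP ir => // ->; rewrite (negPf jr).
rewrite not_implyE => -[x0r /negP]; rewrite -ltNge => x0c.
have x0j : 0 < \sum_v x0 v * a j v.
  rewrite ltNge; apply/negP => x0j; move: x0c; rewrite ltNge H // => i.
  by rewrite inE => /orP[/eqP-> //|]; exact: x0r.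
pose d (f : W -> R) := \sum_v x0 v * f v.
have dE f : d f = \sum_v x0 v * f v by [].
have [|w w0 wc] := IH (fun i v => a i v - d (a i) / d (a j) * a j v)
   (fun v => c v - d c / d (a j) * a j v) ur.
  move=> y yr.
  pose t := (\sum_v y v * a j v) / d (a j).
  have sumE f : \sum_v (y v - t * x0 v) * f v =
      \sum_v y v * (f v - d f / d (a j) * a j v).
    transitivity (\sum_v y v * f v - t * d f).
      rewrite /d mulr_sumr -sumrB; apply: eq_bigr => v _; ring.
    transitivity (\sum_v y v * f v - d f / d (a j) * \sum_v y v * a j v).
      by rewrite /t; ring.
    rewrite mulr_sumr -sumrB; apply: eq_bigr => v _; ring.
  rewrite -sumE; apply: H => i; rewrite inE => /orP[/eqP->|ir].
    rewrite sumE big1 // => v _; rewrite divff ?mul1r ?subrr ?mulr0 //.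
    by rewrite gt_eqF.
  by rewrite sumE; apply: yr.
(* The coefficient of [a j] is the one for which both sides pair equally with [x0]. It is
   nonnegative since [x0] is positive on [c] and [a j] and nonpositive on the other constraints. *)
exists (fun i => if i == j then (d c - \sum_(l <- r) w l * d (a l)) / d (a j) else w i).
  move=> i; case: ifP => // _; apply: divr_ge0; last exact: ltW.
  rewrite subr_ge0; apply: le_trans (ltW x0c); rewrite big_seq_cond.
  by apply: sumr_le0 => l /andP[lr _]; apply: mulr_ge0_le0 => //; apply: x0r.
move=> v; rewrite big_cons eqxx.
rewrite [X in _ + X](eq_big_seq (fun i => w i * a i v)); last first.
  by move=> i ir; case: (i =P j) ir => [->|_ _]; rewrite ?(negPf jr).
have /eqP := wc v; rewrite subr_eq => /eqP ->.
have -> : \sum_(i <- r) w i * (a i v - d (a i) / d (a j) * a j v) =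
    \sum_(i <- r) w i * a i v - (\sum_(i <- r) w i * d (a i)) / d (a j) * a j v.
  by rewrite !mulr_suml -sumrB; apply: eq_bigr => i _; ring.
ring.
Qed.

(* The right-hand side is the mean of the left-hand side for [theta] uniform in
   [0, 1). *)
Lemma threshold_rounding (R : realType) (W : finType) (c lam : W -> R) :
  (forall v, 0 <= lam v <= 1) ->
  exists2 theta : R, 0 <= theta < 1 &
    \sum_v (if theta < lam v then c v else 0) <= \sum_v c v * lam v.
Proof.
have [n] := ubnP #|[set v | 0 < lam v]|; elim: n lam => // n IH lam.
rewrite ltnS => cardn lam01.
pose S := [set v | 0 < lam v].
have lam0 v : v \notin S -> lam v = 0.
  by rewrite inE -leNgt => lv; apply/eqP; rewrite eq_le lv; case/andP: (lam01 v).
have [S0|[v1 v1S]] := set_0Vmem S.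
  exists 0; rewrite ?lexx ?ltr01 // ler_sum // => v _.
  by rewrite lam0 ?S0 ?inE // ltxx mulr0.
(* Thresholds below the least positive value [a] all cost the sum over [S]; those from [a] on
   correspond, after rescaling, to [lam']. For [a < 1], [h] is the mean of the two costs with
   weights [a] and [1 - a], so the second is below [h] if the first is above it. *)
pose v0 := [arg min_(v < v1 in S) lam v]%O.
have [v0S v0min] : v0 \in S /\ forall v, v \in S -> lam v0 <= lam v.
  by rewrite /v0; case: arg_minP => // v vS vmin; split.
set a := lam v0 in v0min.
have a0 : 0 < a by move: v0S; rewrite inE.
have /andP[_ a1] := lam01 v0; rewrite -/a in a1.
pose h := \sum_v c v * lam v.
have [hS|hS] := leP (\sum_(v in S) c v) h.
  exists 0; rewrite ?lexx ?ltr01 //; apply: le_trans hS.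
  by rewrite [leRHS]big_mkcond /=; apply: ler_sum => v _; rewrite inE.
move: a1; rewrite le_eqVlt => /orP[/eqP a1|a1].
  move: hS; rewrite /h [in ltRHS]big_mkcond /= ltNge => /negP[]; apply: ler_sum => v _.
  case: ifP => [vS|/negbT/lam0->]; last by rewrite mulr0.
  have -> : lam v = 1.
    by apply/eqP; rewrite eq_le; case/andP: (lam01 v) => _ ->; rewrite -a1 v0min.
  by rewrite mulr1.
pose lam' v := if v \in S then (lam v - a) / (1 - a) else 0.
have a1' : 0 < 1 - a by rewrite subr_gt0.
have [|v|th /andP[th0 th1] Hth] := IH lam'.
- apply: leq_trans cardn; apply: proper_card; apply/properP; split.
    by apply/subsetP => v; rewrite /lam' !inE; case: ifP => //; rewrite ltxx.
  by exists v0 => //; rewrite /lam' inE v0S /a subrr mul0r ltxx.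
- rewrite /lam'; case: ifP => [vS|_]; last by rewrite lexx ler01.
  rewrite divr_ge0 ?(ltW a1') ?subr_ge0 ?v0min //= ler_pdivrMr // mul1r lerD2r.
  by case/andP: (lam01 v).
exists (a + (1 - a) * th).
  apply/andP; split; first by apply: addr_ge0; [exact: ltW | apply: mulr_ge0 => //; exact: ltW].
  by rewrite -ltrBrDl -[ltRHS]mulr1 ltr_pM2l.
have -> : \sum_v (if a + (1 - a) * th < lam v then c v else 0) =
    \sum_v (if th < lam' v then c v else 0).
  apply: eq_bigr => v _; rewrite /lam'; case: (boolP (v \in S)) => vS /=.
    by rewrite ltr_pdivlMr // ltrBrDl [th * _]mulrC.
  rewrite lam0 // !ltNge th0 /= addr_ge0 ?(ltW a0) //.
  by rewrite mulr_ge0 // ltW.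
apply: le_trans Hth _; rewrite -/h.
have hE : h = a * \sum_(v in S) c v + (1 - a) * \sum_v c v * lam' v.
  rewrite [in RHS]big_mkcond /= /h !mulr_sumr -big_split /=; apply: eq_bigr => v _.
  rewrite /lam'; case: ifPn => [vS|/lam0->]; last by rewrite !mulr0 addr0.
  by field; rewrite gt_eqF.
have : a * h < a * \sum_(v in S) c v by rewrite ltr_pM2l.
rewrite -(ler_pM2l a1'); lra.
Qed.

(* Along [p / al + q / be = n] the left-hand side is a convex function of [p], so
   it is at most its larger value at the ends [p = 0] and [q = 0]. *)
Lemma chord_bound (R : realType) (al be n p q M : R) :
  0 < al -> al <= be -> 0 <= p -> 0 <= q ->
  p / al + q / be <= n -> 1 - (1 - al) ^+ 2 <= M -> be ^+ 2 <= M ->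
  n ^+ 2 - (n - p) ^+ 2 + q ^+ 2 <= M * n ^+ 2.
Proof.
move=> al0 albe p0 q0 H M1 M2.
have be0 : 0 < be by lra.
pose t := p / al; have pE : p = al * t by rewrite /t; field; rewrite gt_eqF.
pose s := q / be; have qE : q = be * s by rewrite /s; field; rewrite gt_eqF.
have t0 : 0 <= t by rewrite divr_ge0 // ltW.
have s0 : 0 <= s by rewrite divr_ge0 // ltW.
rewrite -/t -/s in H; rewrite pE qE.
have s2 : s ^+ 2 <= (n - t) ^+ 2 by rewrite ler_sqr ?nnegrE; lra.
have b2 : be ^+ 2 * s ^+ 2 <= be ^+ 2 * (n - t) ^+ 2 by rewrite ler_wpM2l // sqr_ge0.
have h1 : 0 <= (be ^+ 2 - al ^+ 2) * (t * (n - t)).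
  apply: mulr_ge0; last by apply: mulr_ge0; lra.
  by rewrite subr_ge0 ler_sqr ?nnegrE; lra.
have h2 : 0 <= (M - be ^+ 2) * ((n - t) * n) by apply: mulr_ge0; [lra | apply: mulr_ge0; lra].
have h3 : 0 <= (M - (1 - (1 - al) ^+ 2)) * (t * n) by apply: mulr_ge0; [lra | apply: mulr_ge0; lra].
rewrite exprMn; lra.
Qed.

(** After rounding, the vertices of [P] have value [1 / tau1], those of [Q] value
    [1 / (tau1 + tau2)] and all others 0, at total cost at most [#|W|]. Each pair of [E] meets [P]
    or lies inside [Q], and counting such pairs gives the left-hand side of [chord_bound]. *)
Lemma cover_pairs (R : realType) (W : finType) (tau1 tau2 : R) (z : W -> R)
    (E : {set W * W}) :
  0 < tau1 -> tau1 <= tau2 -> (forall v, 0 <= z v) -> \sum_v z v <= #|W|%:R ->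
  (forall a b, (a, b) \in E ->
     1 <= tau1 * z a + tau2 * z b /\ 1 <= tau1 * z b + tau2 * z a) ->
  #|E|%:R <= Num.max (1 - (1 - tau1) ^+ 2) ((tau1 + tau2) ^+ 2) * #|W|%:R ^+ 2.
Proof.
move=> t10 t12 z0 zn Ez.
set be := tau1 + tau2.
have be0 : 0 < be by rewrite /be; lra.
pose u := tau1^-1; pose w := be^-1.
have tu : tau1 * u = 1 by rewrite /u divff ?gt_eqF.
have bw : be * w = 1 by rewrite /w divff ?gt_eqF.
have u0 : 0 < u by rewrite invr_gt0.
have w0 : 0 < w by rewrite invr_gt0.
have uw : 0 < u - w.
  rewrite subr_gt0 -(ltr_pM2l be0) bw -(ltr_pM2l t10) mulr1 mulrCA tu mulr1 /be; lra.
(* A high value is rounded to [u] or [w], a low one to [0] or [w]. The probability [lam] of choosing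
   [w] preserves the mean, except that values above [u] drop to [u]; [c] is the change in cost when
   [w] is chosen. *)
pose high v := w <= z v.
pose lam v := if high v then (if z v <= u then (u - z v) / (u - w) else 0) else be * z v.
pose c v := if high v then - (u - w) else w.
have lam01 v : 0 <= lam v <= 1.
  rewrite /lam /high; have [h|h] := leP w (z v); last first.
    by apply/andP; split; [apply: mulr_ge0 => //; exact: ltW | rewrite -bw ler_pM2l // ltW].
  have [h2|h2] := leP (z v) u; last by rewrite lexx ler01.
  apply/andP; split; first by apply: divr_ge0; lra.
  by rewrite ler_pdivrMr //; lra.
have [th /andP[th0 th1] Hth] := threshold_rounding c lam01.
pose P := [set v | high v & lam v <= th].
pose Q := [set v | th < lam v].
have cost : #|P|%:R / tau1 + #|Q|%:R / be <= #|W|%:R.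
  rewrite -/u -/w; apply: le_trans zn.
  have -> : #|P|%:R * u = \sum_v (if v \in P then u else 0).
    by rewrite mulr_natl -sumr_const big_mkcond.
  have -> : #|Q|%:R * w = \sum_v (if v \in Q then w else 0).
    by rewrite mulr_natl -sumr_const big_mkcond.
  rewrite -big_split /=.
  apply: (@le_trans _ _ (\sum_v (if high v then u else 0) +
     \sum_v (if th < lam v then c v else 0))).
    rewrite -big_split /=; apply: ler_sum => v _; rewrite !inE /c.
    by case: (high v) => /=; case: ltP => _ /=; lra.
  apply: le_trans (lerD (lexx _) Hth) _.
  rewrite -big_split /=; apply: ler_sum => v _; rewrite /c /lam.
  case: ifP => // hv; last by rewrite mulrA [w * be]mulrC bw mul1r add0r.
  have [h2|h2] := leP (z v) u; last by rewrite mulr0 addr0 ltW.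
  by rewrite mulNr mulrC mulfVK ?gt_eqF //; lra.
have EPQ a b : (a, b) \in E -> a \notin P -> b \notin P -> (a \in Q) && (b \in Q).
  (* If one endpoint is high and the other low, the covering constraint says
     exactly that the low endpoint has the larger [lam]. *)
  have key x y : 1 <= tau1 * z x + tau2 * z y -> high x -> ~~ high y ->
      x \notin P -> (x \in Q) && (y \in Q).
    rewrite !inE => xy hx hy; rewrite hx /= -ltNge => thx; rewrite thx /=.
    apply: lt_le_trans thx _; rewrite /lam hx (negPf hy).
    have [xu|xu] := leP (z x) u; last by apply: mulr_ge0 => //; exact: ltW.
    rewrite ler_pdivrMr //.
    have t20 : 0 < tau2 by lra.
    have t2u : tau2 * w = tau1 * (u - w) by rewrite mulrBr tu -bw /be; ring.
    have xyu : tau1 * (u - z x) <= tau2 * z y by rewrite mulrBr tu; lra.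
    rewrite -(ler_pM2l t10); have -> : tau1 * (be * z y * (u - w)) = tau2 * z y.
      transitivity (be * z y * (tau1 * (u - w))); first by ring.
      rewrite -t2u; transitivity (tau2 * z y * (be * w)); first by ring.
      by rewrite bw mulr1.
    exact: xyu.
  move=> /[dup] abE /Ez[ab ba] aP bP.
  have [ha|ha] := boolP (high a); have [hb|hb] := boolP (high b).
  - by move: aP bP; rewrite !inE ha hb /= -!ltNge => -> ->.
  - exact: key ab ha hb aP.
  - by rewrite andbC; exact: key ba hb ha bP.
  - have low x : ~~ high x -> be * z x < 1 by rewrite -ltNge -bw ltr_pM2l.
    move: ha hb => /low ha /low hb; exfalso.
    have : tau1 * (be * z a) < tau1 by rewrite -[ltRHS]mulr1 ltr_pM2l.
    have : tau2 * (be * z b) < tau2 by rewrite -[ltRHS]mulr1 ltr_pM2l //; lra.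
    have : be * 1 <= be * (tau1 * z a + tau2 * z b) by rewrite ler_pM2l.
    by rewrite /be; lra.
have cardE : (#|E| + (#|W| - #|P|) ^ 2 <= #|W| ^ 2 + #|Q| ^ 2)%N.
  have EU : E \subset ~: setX (~: P) (~: P) :|: setX Q Q.
    apply/subsetP => -[a b] abE; rewrite in_setU in_setC !in_setX /= !in_setC.
    by have := EPQ a b abE; case: (a \in P); case: (b \in P) => //= ->.
  have := leq_trans (subset_leq_card EU) (leq_card_setU _ _).1.
  rewrite [X in (_ <= _ + X)%N]cardsX [#|~: setX _ _|]cardsCs setCK cardsX card_prod.
  rewrite [#|~: P|]cardsCs setCK.
  have PP : ((#|W| - #|P|) * (#|W| - #|P|) <= #|W| * #|W|)%N.
    by apply: leq_mul; exact: leq_subr.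
  by move=> H; rewrite -!mulnn -{1}(subnK PP) addnAC leq_add2r.
have PW : (#|P| <= #|W|)%N by exact: max_card.
have tbe : tau1 <= be by rewrite /be; lra.
set M := Num.max _ _.
have M1 : 1 - (1 - tau1) ^+ 2 <= M by rewrite le_max lexx.
have M2 : be ^+ 2 <= M by rewrite le_max lexx orbT.
apply: le_trans (chord_bound t10 tbe (ler0n _ _) (ler0n _ _) cost M1 M2).
move: cardE; rewrite -(ler_nat R) !natrD !natrX natrB //; lra.
Qed.

(** * Mapping the parts of a complete partite graph onto an edge *)

Lemma sum_pblock (M : nmodType) (V : finType) (P : {set {set V}}) (f : {set V} -> M) :
  partition P [set: V] ->
  \sum_x f (pblock P x) = \sum_(C in P) f C *+ #|C|.
Proof.
move=> PV; have /and3P[_ tP _] := PV.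
rewrite (eq_bigl (fun x => x \in [set: V])); last by move=> x; rewrite inE.
rewrite (set_partition_big _ PV) /=; apply: eq_bigr => C CP.
by rewrite -sumr_const; apply: eq_bigr => x xC; rewrite (def_pblock tP CP xC).
Qed.

Lemma sum_preim (R : pzSemiRingType) (V W : finType) (f : V -> W) (y : W -> R) :
  \sum_v y v * #|f @^-1: [set v]|%:R = \sum_x y (f x).
Proof.
rewrite (partition_big f predT) //=; apply: eq_bigr => v _.
rewrite (eq_bigr (fun=> y v)) => [|x /eqP->//]; rewrite sumr_const mulr_natr.
by congr (_ *+ _); apply: eq_card => x; rewrite !inE.
Qed.

Lemma ex_imset_eq (T W : finType) (w0 : W) (X : {set T}) (Y : {set W}) :
  #|X| = #|Y| -> exists f : T -> W, f @: X = Y.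
Proof.
move=> XY; exists (fun t => nth w0 (enum Y) (index t (enum X))).
apply/setP => w; apply/imsetP/idP => [[t tX ->]|wY].
  by rewrite -mem_enum mem_nth // -cardE -XY cardE index_mem mem_enum.
have wi : (index w (enum Y) < size (enum X))%N.
  by rewrite -cardE XY cardE index_mem mem_enum.
have t0 : T by case: (enum X) wi.
exists (nth t0 (enum X) (index w (enum Y))); first by rewrite -mem_enum mem_nth.
by rewrite index_uniq ?enum_uniq // nth_index // mem_enum.
Qed.

Lemma ex_imset_eq2 (T W : finType) (X : {set T}) (Y : {set W}) (A B : T) (a b : W) :
  A \in X -> B \in X -> A != B -> a \notin Y -> b \notin Y -> a != b ->
  #|X| = #|Y|.+2 ->
  exists f : T -> W, [/\ f A = a, f B = b, f @: X = a |: (b |: Y) &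
    f @: (X :\ A :\ B) = Y].
Proof.
move=> AX BX AB aY bY ab XY.
have BXA : B \in X :\ A by rewrite !inE eq_sym AB.
have [|f fXY] := @ex_imset_eq T W a (X :\ A :\ B) Y.
  by apply/eqP; rewrite -2!eqSS -XY (cardsD1 A X) AX (cardsD1 B (X :\ A)) BXA.
pose g t := if t == A then a else if t == B then b else f t.
have gf : g @: (X :\ A :\ B) = Y.
  rewrite -fXY; apply: eq_in_imset => t; rewrite !inE /g => /and3P[tB tA _].
  by rewrite (negPf tA) (negPf tB).
have gA : g A = a by rewrite /g eqxx.
have gB : g B = b by rewrite /g eq_sym (negPf AB) eqxx.
by exists g; split=> //; rewrite -(setD1K AX) -(setD1K BXA) !imsetU !imset_set1 gf gA gB.
Qed.

Section CompletePartite.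
Variables (k : nat) (V : finType) (F : kgraph k V) (P : {set {set V}}).
Hypothesis FP : complete_partite F P.

Lemma parts_partition : partition P [set: V]. Proof. by case: FP. Qed.
Lemma card_parts : #|P| = k. Proof. by case: FP. Qed.

Lemma pblock_part x : pblock P x \in P.
Proof. by rewrite pblock_mem // (cover_partition parts_partition) inE. Qed.

Lemma mem_pblock_part x : x \in pblock P x.
Proof. by rewrite mem_pblock (cover_partition parts_partition) inE. Qed.

Lemma part_pblock C x : C \in P -> x \in C -> pblock P x = C.
Proof. by have /and3P[_ tP _] := parts_partition; exact: def_pblock. Qed.

Lemma part_inhabited C : C \in P -> exists x, x \in C.
Proof.
move=> CP; apply/set0Pn; apply: contraTneq CP => ->.
by have /and3P[] := parts_partition.
Qed.

Lemma edge_part e C : e \in edges F -> C \in P -> exists x, e :&: C = [set x].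
Proof.
by case: FP => _ _ ->; rewrite inE => /andP[_ /forall_inP/(_ C)] h /h /cards1P.
Qed.

Lemma edge_pblock_imset e : e \in edges F -> pblock P @: e = P.
Proof.
move=> eF; apply/setP => C; apply/imsetP/idP => [[x _ ->]|CP]; first exact: pblock_part.
have [x xeC] := edge_part eF CP.
have : x \in e :&: C by rewrite xeC set11.
by rewrite inE => /andP[xe xC]; exists x; rewrite ?(part_pblock CP xC).
Qed.

Lemma edge_pblock_inj e : e \in edges F -> {in e &, injective (pblock P)}.
Proof.
move=> eF; apply/imset_injP.
by rewrite (edge_pblock_imset eF) (edges_uniform eF) card_parts.
Qed.

Lemma transversal_edge (g : {set V} -> V) :
  (forall C, C \in P -> g C \in C) -> g @: P \in edges F.
Proof.
move=> gP; case: (FP) => _ _ ->; rewrite inE card_in_imset; last first.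
  move=> C D CP DP gCD; rewrite -(part_pblock CP (gP C CP)) gCD.
  exact: part_pblock (gP D DP).
rewrite card_parts eqxx; apply/forall_inP => C CP; apply/cards1P; exists (g C).
apply/setP => x; rewrite !inE; apply/andP/eqP => [[/imsetP[D DP ->] gC]|->].
  by rewrite -(part_pblock CP gC) (part_pblock DP (gP D DP)).
by split; [exact: imset_f | exact: gP].
Qed.

Lemma ex_transversal_through (x y : V) : pblock P x != pblock P y ->
  exists g : {set V} -> V, [/\ forall C, C \in P -> g C \in C,
    g (pblock P x) = x & g (pblock P y) = y].
Proof.
move=> xy; pose g (C : {set V}) := if C == pblock P x then x else
   if C == pblock P y then y else odflt x [pick z in C].
have gx : g (pblock P x) = x by rewrite /g eqxx.
have gy : g (pblock P y) = y by rewrite /g eq_sym (negPf xy) eqxx.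
exists g; split=> //.
move=> C CP; rewrite /g; case: eqP => [->|_]; first exact: mem_pblock_part.
case: eqP => [->|_]; first exact: mem_pblock_part.
case: pickP => // C0; have [z zC] := part_inhabited CP.
by have := C0 z; rewrite zC.
Qed.

(** An edge of [F] meets every part, so a map that is constant on the parts sends each edge to the
    whole of [s @: P]. *)
Lemma hom_pblock (W : finType) (G : kgraph k W) (s : {set V} -> W) :
  s @: P \in edges G -> [ffun x => s (pblock P x)] \in homs F G.
Proof.
move=> sG; rewrite inE; apply/forall_inP => e eF.
rewrite (_ : _ @: e = s @: P) //; transitivity (s @: (pblock P @: e)).
  by rewrite -imset_comp; apply: eq_imset => x; rewrite /= ffunE.
by rewrite (edge_pblock_imset eF).
Qed.

End CompletePartite.

(** * Dual weights and the existence of fractional tilings *)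

Lemma ex_top (R : realType) (W : finType) (y : W -> R) (j : nat) :
  (j < #|W|)%N ->
  exists (S : {set W}) (t : W), [/\ #|S| = j.+1, t \in S,
    forall s, s \in S -> y t <= y s & forall v, v \notin S -> y v <= y t].
Proof.
elim: j => [|j IH] jW.
  have [w0 _] : exists w0, w0 \in W by apply/card_gt0P.
  pose t := [arg max_(v > w0) y v]%O.
  have tmax v : y v <= y t by rewrite /t; case: arg_maxP => // ? _; apply.
  exists [set t], t; rewrite cards1 set11; split=> // s; first by rewrite inE => /eqP->.
have [S [t [Sj tS St tmax]]] := IH (ltnW jW).
have [w0 w0S] : exists w0, w0 \in ~: S.
  by apply/card_gt0P; rewrite cardsCs setCK subn_gt0 Sj.
pose u := [arg max_(v > w0 in ~: S) y v]%O.
have [uS umax] : u \notin S /\ forall v, v \notin S -> y v <= y u.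
  rewrite /u; case: arg_maxP => // v; rewrite inE => vS vmax; split=> // x xS.
  by apply: vmax; rewrite inE.
exists (u |: S), u; rewrite cardsU1 uS Sj setU11; split=> // [s|v]; rewrite !inE.
  by case/orP => [/eqP->//|/St]; apply: le_trans; exact: tmax.
by rewrite negb_or => /andP[_]; exact: umax.
Qed.

Lemma sum_card_parts (V : finType) (P : {set {set V}}) (A B : {set V}) :
  partition P [set: V] -> A \in P -> B \in P -> A != B ->
  (#|A| + (#|B| + \sum_(C in P :\ A :\ B) #|C|) = #|V|)%N.
Proof.
move=> PV AP BP AB; have BPA : B \in P :\ A by rewrite !inE eq_sym AB.
have := card_partition PV; rewrite cardsT => ->.
by rewrite (big_setD1 A AP) /= (big_setD1 B BPA).
Qed.

(** Farkas' lemma yields nonnegative weights; they are at most 1 because each [phi] covers the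
    vertex [phi x0] at least once. *)
Lemma Spa_of_farkas (R : realType) (k : nat) (V W : finType) (F : kgraph k V)
    (G : kgraph k W) :
  (0 < #|V|)%N ->
  (forall y : W -> R, (forall phi, phi \in homs F G -> \sum_x y (phi x) <= 0) ->
     \sum_v y v <= 0) ->
  Spa R F G.
Proof.
move=> /card_gt0P[x0 _] H.
have [|w w0 wE] := @farkas R W _ (enum (homs F G))
   (fun phi v => #|phi @^-1: [set v]|%:R) (fun=> 1) (enum_uniq _).
  move=> y yH; under eq_bigr do rewrite mulr1.
  by apply: H => phi; rewrite -mem_enum -sum_preim; exact: yH.
have wT : perfect_tiling F G w.
  by move=> v; apply: etrans (esym (wE v)); rewrite big_enum.
exists w; split=> // phi phiH; rewrite w0 /= -(wT (phi x0)) (bigD1 phi) //=.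
have s0 : 0 <= \sum_(i in homs F G | i != phi) w i * #|i @^-1: [set phi x0]|%:R.
  by apply: sumr_ge0 => i _; apply: mulr_ge0.
have : 1 <= #|phi @^-1: [set phi x0]|%:R :> R.
  by rewrite (ler_nat R 1) card_gt0; apply/set0Pn; exists x0; rewrite !inE.
move=> /(ler_wpM2l (w0 phi)); lra.
Qed.

(** Here [n] and [m] are the orders of [G] and [F], [y0] is the lowest weight on [S], [X] the total
    excess of [S] over it, [Z] the total defect, and [s] the contribution of the parts mapped to
    [S]. The reason is the identity [n (m y0 + X) - m Z = m (n y0 - Z + X) + (n - m) X]. *)
Lemma dual_edge_bound (R : realFieldType) (n m y0 Z X al be za zb s : R) :
  0 < n -> 0 < m -> m <= n -> 0 <= X -> 0 < n * y0 - Z + X ->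
  y0 * (m - al - be) + X <= s ->
  (y0 - za) * al + ((y0 - zb) * be + s) <= 0 ->
  m * Z < n * (al * za + be * zb).
Proof.
move=> n0 m0 mn X0 pos h1 h2.
have h3 : m * y0 + X <= al * za + be * zb by lra.
have : n * (m * y0 + X) <= n * (al * za + be * zb) by rewrite ler_pM2l.
apply: lt_le_trans.
have : m * 0 < m * (n * y0 - Z + X) by rewrite ltr_pM2l.
have : 0 <= (n - m) * X by apply: mulr_ge0; lra.
by lra.
Qed.

Lemma Spa_of_link_pairs (R : realType) (k : nat) (V W : finType) (F : kgraph k V)
    (P : {set {set V}}) (A B : {set V}) (G : kgraph k W) :
  (3 <= k)%N -> complete_partite F P -> A \in P -> B \in P -> A != B ->
  (#|A| <= #|B|)%N -> (k <= #|V| <= #|W|)%N ->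
  (forall S : {set W}, #|S|.+2 = k ->
     Num.max (1 - (1 - rel_size R A) ^+ 2) ((rel_size R A + rel_size R B) ^+ 2)
       * #|W|%:R ^+ 2 < #|link_pairs G S|%:R) ->
  Spa R F G.
Proof.
move=> k3 FP AP BP AB cAB /andP[kV VW] Hlink.
have PV := parts_partition FP.
have A0 : (0 < #|A|)%N.
  by have [x xA] := part_inhabited FP AP; apply/card_gt0P; exists x.
have V0 : (0 < #|V|)%N by lia.
apply: Spa_of_farkas => // y yH; rewrite leNgt; apply/negP => ypos.
(* [ex_top] returns one vertex more than its index, hence [k - 2] vertices. *)
have [|S [t [Sk tS St tmax]]] := @ex_top R W y (k - 3); first by lia.
have {}Sk : #|S|.+2 = k by lia.
pose y0 := y t; pose z v := if v \in S then 0 else y0 - y v.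
have z0 v : 0 <= z v.
  by rewrite /z; case: ifPn => // /tmax; rewrite subr_ge0.
pose Z := \sum_v z v; pose X := \sum_(s in S) (y s - y0).
have X0 : 0 <= X by apply: sumr_ge0 => s /St; rewrite subr_ge0.
have Z0 : 0 <= Z by apply: sumr_ge0.
pose n : R := #|W|%:R; pose m : R := #|V|%:R; pose al : R := #|A|%:R; pose be : R := #|B|%:R.
have n0 : 0 < n by rewrite ltr0n; lia.
have m0 : 0 < m by rewrite ltr0n.
have mn : m <= n by rewrite ler_nat.
have sumy : \sum_v y v = n * y0 - Z + X.
  rewrite /n mulr_natl -(sumr_const W) /Z /X big_mkcond /= -sumrB.
  rewrite [\sum_(s in S) _]big_mkcond /= -big_split /=; apply: eq_bigr => v _.
  by rewrite /z; case: ifP => _; lra.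
have link_ineq a b : (a, b) \in link_pairs G S -> m * Z < n * (al * z a + be * z b).
  move=> abG; have [ab aS bS] := link_pair_spec Sk abG.
  have [|s [sA sB sP sD]] := ex_imset_eq2 AP BP AB aS bS ab; first by rewrite (card_parts FP).
  have sinj : {in P &, injective s}.
    apply/imset_injP; rewrite sP (card_parts FP) (@edges_uniform _ _ G) //.
    by move: abG; rewrite inE.
  have sG : s @: P \in edges G by rewrite sP; move: abG; rewrite inE.
  have := yH _ (hom_pblock FP sG).
  under eq_bigr do rewrite ffunE.
  rewrite (sum_pblock (fun C => y (s C)) PV).
  have BPA : B \in P :\ A by rewrite !inE eq_sym AB.
  rewrite (big_setD1 A) //= (big_setD1 B) //= sA sB.
  have ya : y a = y0 - z a by rewrite /z (negPf aS); lra.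
  have yb : y b = y0 - z b by rewrite /z (negPf bS); lra.
  (* Each remaining part has at least one vertex, so beyond [y0] per vertex it contributes at least
     the excess of its image. *)
  have : y0 * (m - al - be) + X <= \sum_(C in P :\ A :\ B) y (s C) *+ #|C|.
    have -> : m - al - be = \sum_(C in P :\ A :\ B) #|C|%:R.
      by rewrite -natr_sum /m -(sum_card_parts PV AP BP AB) !natrD /al /be; lra.
    rewrite /X -sD big_imset /=; last first.
      by move=> C D; rewrite !inE => /and3P[_ _ CP] /and3P[_ _ DP]; exact: sinj.
    rewrite mulr_sumr -big_split /=; apply: ler_sum => C CD.
    have CP : C \in P by move: CD; rewrite !inE => /and3P[].
    have C1 : 1 <= #|C|%:R :> R.
      rewrite (ler_nat R 1) card_gt0; apply/set0Pn; exact: (part_inhabited FP CP).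
    have ys : y0 <= y (s C) by apply: St; rewrite -sD imset_f.
    rewrite -mulr_natr; nra.
  rewrite -[y a *+ _]mulr_natr -[y b *+ _]mulr_natr ya yb => h1 h2.
  rewrite sumy in ypos.
  exact: (dual_edge_bound n0 m0 mn X0 ypos h1 h2).
have linkC a b : (a, b) \in link_pairs G S -> (b, a) \in link_pairs G S.
  by rewrite !inE /= setUCA.
have := Hlink S Sk; set M := Num.max _ _ => HS.
have M0 : 0 <= M by rewrite le_max sqr_ge0 orbT.
have Zpos : 0 < Z.
  rewrite lt_neqAle Z0 andbT eq_sym; apply/negP => /eqP Ze.
  have /card_gt0P[[a b] abG] : (0 < #|link_pairs G S|)%N.
    by rewrite -(ltr_nat R); apply: le_lt_trans HS; rewrite mulr_ge0 ?sqr_ge0.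
  have zz v : z v = 0.
    have /eqP : Z == 0 by rewrite Ze.
    by move=> /eqP; rewrite psumr_eq0 // => /allP/(_ v); rewrite mem_index_enum => /(_ isT)/eqP.
  by have := link_ineq _ _ abG; rewrite !zz Ze !mulr0 addr0 mulr0 ltxx.
(* Scaling by [n / Z] brings the average of [z] to 1. *)
have := @cover_pairs R W (rel_size R A) (rel_size R B) (fun v => z v * (n / Z)) (link_pairs G S).
have t10 : 0 < rel_size R A by apply: divr_gt0 => //; rewrite ltr0n.
have t12 : rel_size R A <= rel_size R B by rewrite ler_pM2r ?invr_gt0 // ler_nat.
have nZ0 : 0 <= n / Z by apply: divr_ge0; exact: ltW.
have zZ v : 0 <= z v * (n / Z) by apply: mulr_ge0.
have zZn : \sum_v z v * (n / Z) <= n by rewrite -mulr_suml -/Z mulrC mulfVK ?gt_eqF.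
have key a b : (a, b) \in link_pairs G S ->
    1 <= rel_size R A * (z a * (n / Z)) + rel_size R B * (z b * (n / Z)).
  move=> /link_ineq h; rewrite /rel_size -/al -/be -/m.
  have -> : al / m * (z a * (n / Z)) + be / m * (z b * (n / Z)) =
     n * (al * z a + be * z b) / (m * Z) by field; rewrite !gt_eqF.
  by rewrite ler_pdivlMr ?mul1r ?(ltW h) // mulr_gt0.
move=> /(_ t10 t12 zZ zZn (fun a b abG => conj (key a b abG) (key b a (linkC a b abG)))).
by rewrite -/M leNgt HS.
Qed.

(** * Space barriers *)

Lemma card_le_link_pairs (k : nat) (W : finType) (G : kgraph k W) (S : {set W})
    (T : {set W * W}) :
  #|S|.+2 = k ->
  (forall a b, (a, b) \in T -> a != b -> a \notin S -> b \notin S ->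
     a |: (b |: S) \in edges G) ->
  (#|T| <= #|link_pairs G S| + 2 * k * #|W|)%N.
Proof.
move=> Sk TG; pose diag := [set (a, a) | a : W].
(* Only pairs that meet [S] or lie on the diagonal are lost, at most [2 (k - 2) n + n] of them. *)
have TU : T \subset link_pairs G S :|: (setX S setT :|: setX setT S :|: diag).
  apply/subsetP => -[a b] abT; rewrite !in_setU !in_setX !in_setT andbT /=.
  have [aS|aS] := boolP (a \in S); first by rewrite orbT.
  have [bS|bS] := boolP (b \in S); first by rewrite !orbT.
  have [<-|ab] := eqVneq a b; first by rewrite [_ \in diag]imset_f ?orbT.
  by rewrite inE /= TG.
apply: leq_trans (subset_leq_card TU) _; apply: leq_trans (leq_card_setU _ _).1 _.
rewrite leq_add2l; apply: leq_trans (leq_card_setU _ _).1 _.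
apply: leq_trans (leq_add (leq_card_setU _ _).1 (leq_imset_card _ _)) _.
rewrite !cardsX cardsT -Sk; move: #|S| #|W| => s n; nia.
Qed.

Lemma ex_set_card (n x : nat) : (x <= n)%N -> exists X : {set 'I_n}, #|X| = x.
Proof.
move=> xn; exists [set widen_ord xn i | i : 'I_x].
by rewrite card_imset ?card_ord // => i j /(congr1 val) /= /val_inj.
Qed.

Lemma ex_nat_linear_le (R : realType) (c e : R) (N0 : nat) : 0 < e ->
  exists N : nat, [/\ (N0 <= N)%N, (0 < N)%N & c * N%:R <= e * N%:R ^+ 2].
Proof.
move=> e0; have [N1 HN] := archi_nat (c / e).
exists (maxn (maxn N0 1) N1); split; [lia | lia | ].
set N := maxn _ _; rewrite expr2 mulrA; apply: ler_wpM2r => //.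
rewrite mulrC -ler_pdivrMr //; apply: le_trans HN _; rewrite ler_nat; exact: leq_maxr.
Qed.

Lemma tiling_sum (R : realType) (k : nat) (V W : finType) (F : kgraph k V)
    (G : kgraph k W) (w : {ffun V -> W} -> R) (X : {set W}) :
  perfect_tiling F G w ->
  \sum_(phi in homs F G) w phi * #|phi @^-1: X|%:R = #|X|%:R.
Proof.
move=> wT; have -> : #|X|%:R = \sum_(v in X) (1 : R) by rewrite sumr_const.
under [RHS]eq_bigr => v _ do rewrite -(wT v).
rewrite [RHS]exchange_big /=; apply: eq_bigr => phi _.
rewrite -mulr_sumr; congr (_ * _).
transitivity (\sum_v (v \in X)%:R * #|phi @^-1: [set v]|%:R : R).
  rewrite sum_preim -sum1_card natr_sum big_mkcond; apply: eq_bigr => v _.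
  by rewrite inE; case: (_ \in X).
rewrite [RHS]big_mkcond; apply: eq_bigr => v _.
by case: (_ \in X); rewrite ?mul1r ?mul0r.
Qed.

Lemma barrier_uniform (k j : nat) (W : finType) (X : {set W}) (e : {set W}) :
  e \in [set e : {set W} | (#|e| == k) && (j <= #|e :&: X|)%N] -> #|e| = k.
Proof. by rewrite inE => /andP[/eqP]. Qed.

(** The edge set is inferred from [barrier_uniform]: the [k]-sets with at least [j] vertices in
    [X]. *)
Definition space_barrier (k j : nat) (W : finType) (X : {set W}) : kgraph k W :=
  KGraph (@barrier_uniform k j W X).

(** Choose in each part a vertex mapped outside [X], if there is one. The image of this transversal
    is an edge and has [j] vertices in [X], so at least [j] parts are mapped entirely into [X]. *)
Lemma space_barrier_hom (k j : nat) (V W : finType) (F : kgraph k V)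
    (P : {set {set V}}) (X : {set W}) (phi : {ffun V -> W}) :
  (0 < #|V|)%N -> complete_partite F P -> phi \in homs F (space_barrier k j X) ->
  exists Q : {set {set V}}, [/\ Q \subset P, (j <= #|Q|)%N &
    (\sum_(C in Q) #|C| <= #|phi @^-1: X|)%N].
Proof.
move=> /card_gt0P[x0 _] FP; rewrite inE => /forall_inP phiE.
pose Y := phi @^-1: X; pose Q := [set C in P | C \subset Y].
have QP : Q \subset P by apply/subsetP => C; rewrite inE => /andP[].
have /and3P[_ tP _] := parts_partition FP.
exists Q; split=> //; last first.
  have /eqP -> : trivIset Q by apply: trivIsetS tP.
  by apply: subset_leq_card; apply/bigcupsP => C; rewrite inE => /andP[].
(* The implication makes [g C] avoid [Y] unless [C] lies inside [Y]; on a part the default [x0] is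
   never taken. *)
pose g (C : {set V}) := odflt x0 [pick z in C | (z \in Y) ==> (C \subset Y)].
have gC C : C \in P -> g C \in C /\ (g C \in Y -> C \subset Y).
  move=> CP; rewrite /g; case: pickP => [z /andP[zC /implyP zY] //|noz].
  have [z zC] := part_inhabited FP CP.
  have CY : C \subset Y.
    apply/subsetP => u uC; have := noz u; rewrite uC /=.
    by case: (u \in Y).
  by have := noz z; rewrite zC CY implybT.
have gE := phiE _ (transversal_edge FP (fun C CP => (gC C CP).1)).
move: gE; rewrite inE => /andP[_]; move/leq_trans; apply.
apply: leq_trans (leq_imset_card (phi \o g) _); apply: subset_leq_card.
apply/subsetP => v; rewrite inE => /andP[/imsetP[x /imsetP[C CP ->] ->] vX].
apply/imsetP; exists C => //; rewrite inE CP (gC C CP).2 //.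
by rewrite inE.
Qed.

(** Double counting: the total weight times [#|V|] is [#|W|], and each unit of weight uses up at
    least [s] in [X]. *)
Lemma not_Spa_of_small_set (R : realType) (k : nat) (V W : finType)
    (F : kgraph k V) (G : kgraph k W) (X : {set W}) (s : nat) :
  (forall phi, phi \in homs F G -> (s <= #|phi @^-1: X|)%N) ->
  (#|X| * #|V| < s * #|W|)%N -> ~ Spa R F G.
Proof.
move=> sX lt [w [wT w01]].
have := tiling_sum X wT; have := tiling_sum [set: W] wT; rewrite cardsT.
have -> : \sum_(phi in homs F G) w phi * #|phi @^-1: [set: W]|%:R =
    (\sum_(phi in homs F G) w phi) * #|V|%:R.
  by rewrite mulr_suml; apply: eq_bigr => phi _; rewrite preimsetT cardsT.
set w0 := \sum_(phi in homs F G) w phi => wV wX.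
have : s%:R * w0 <= #|X|%:R.
  rewrite -wX mulr_sumr; apply: ler_sum => phi phiH; rewrite mulrC.
  by apply: ler_wpM2l; [case/andP: (w01 _ phiH) | rewrite ler_nat sX].
move/(ler_wpM2r (ler0n R #|V|)); rewrite -mulrA wV -!natrM ler_nat leqNgt.
by rewrite lt.
Qed.

Lemma card_setU2 (k : nat) (W : finType) (S : {set W}) a b : #|S|.+2 = k ->
  a != b -> a \notin S -> b \notin S -> #|a |: (b |: S)| = k.
Proof. by move=> <- ab aS bS; rewrite !cardsU1 !inE negb_or ab aS bS. Qed.

Lemma space_barrier_link1 (R : realType) (k : nat) (W : finType) (X S : {set W})
    (delta : R) :
  #|S|.+2 = k ->
  delta * #|W|%:R ^+ 2 + (2 * k)%:R * #|W|%:R <=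
    #|W|%:R ^+ 2 - (#|W|%:R - #|X|%:R) ^+ 2 ->
  delta * #|W|%:R ^+ 2 <= #|link_pairs (space_barrier k 1 X) S|%:R.
Proof.
move=> Sk h; have TG a b : (a, b) \in ~: setX (~: X) (~: X) -> a != b ->
    a \notin S -> b \notin S -> a |: (b |: S) \in edges (space_barrier k 1 X).
  rewrite in_setC in_setX negb_and !in_setC !negbK => abX ab aS bS.
  rewrite inE (card_setU2 Sk) // eqxx card_gt0; apply/set0Pn.
  by case/orP: abX => h'; [exists a | exists b]; rewrite !inE h' eqxx ?orbT.
have xn : (#|X| <= #|W|)%N by exact: max_card.
have := card_le_link_pairs Sk TG.
rewrite [#|~: setX _ _|]cardsCs setCK cardsX card_prod [#|~: X|]cardsCs setCK.
rewrite -(ler_nat R) natrB; last by apply: leq_mul; exact: leq_subr.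
rewrite natrD !natrM natrB //; rewrite natrM in h; lra.
Qed.

Lemma space_barrier_link2 (R : realType) (k : nat) (W : finType) (X S : {set W})
    (delta : R) :
  #|S|.+2 = k ->
  delta * #|W|%:R ^+ 2 + (2 * k)%:R * #|W|%:R <= #|X|%:R ^+ 2 ->
  delta * #|W|%:R ^+ 2 <= #|link_pairs (space_barrier k 2 X) S|%:R.
Proof.
move=> Sk h; have TG a b : (a, b) \in setX X X -> a != b ->
    a \notin S -> b \notin S -> a |: (b |: S) \in edges (space_barrier k 2 X).
  rewrite in_setX => /andP[aX bX] ab aS bS.
  rewrite inE (card_setU2 Sk) // eqxx /=.
  have <- : #|[set a; b]| = 2%N by rewrite cards2 ab.
  by apply: subset_leq_card; apply/subsetP => x; rewrite !inE => /orP[] /eqP->;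
    rewrite eqxx ?orbT.
have := card_le_link_pairs Sk TG.
rewrite cardsX -(ler_nat R) natrD !natrM; rewrite natrM in h; lra.
Qed.

(** Here [#|W| = m N] and [#|X| = s N - 1]; the hypothesis collects the lower-order losses on its
    left. *)
Lemma barrier1_arith (R : realFieldType) (delta k m s N : R) :
  1 <= N -> s <= m -> 0 < s ->
  (2 * k * m + 2 * m + 1) * N <= (m ^+ 2 - (m - s) ^+ 2 - delta * m ^+ 2) * N ^+ 2 ->
  delta * (m * N) ^+ 2 + 2 * k * (m * N) <= (m * N) ^+ 2 - (m * N - (s * N - 1)) ^+ 2.
Proof. by move=> N1 sm s0 h; nra. Qed.

Lemma barrier2_arith (R : realFieldType) (delta k m s N : R) :
  (2 * k * m + 2 * s) * N <= (s ^+ 2 - delta * m ^+ 2) * N ^+ 2 ->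
  delta * (m * N) ^+ 2 + 2 * k * (m * N) <= (s * N - 1) ^+ 2.
Proof. by move=> h; lra. Qed.

(** A perfect tiling of [#|V| * N] vertices has total weight [N] and would need [s N] vertices of
    [X], which has one fewer. The linear loss [c] is outweighed by the quadratic gain [e] for large
    [N]. *)
Lemma Spa_space_barrier (R : realType) (k j s : nat) (V : finType) (F : kgraph k V)
    (P : {set {set V}}) (delta c e : R) (N0 : nat) :
  complete_partite F P ->
  (forall Q : {set {set V}}, Q \subset P -> (j <= #|Q|)%N -> (s <= \sum_(C in Q) #|C|)%N) ->
  (0 < s <= #|V|)%N -> 0 < e ->
  (forall (N : nat) (X S : {set 'I_(#|V| * N)}), (0 < N)%N -> #|S|.+2 = k ->
     #|X|.+1 = (s * N)%N -> c * N%:R <= e * N%:R ^+ 2 ->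
     delta * (#|V| * N)%:R ^+ 2 <= #|link_pairs (space_barrier k j X) S|%:R) ->
  exists (W : finType) (G : kgraph k W),
     [/\ (N0 <= #|W|)%N, (#|V| %| #|W|)%N,
     (forall S : {set W}, #|S|.+2 = k ->
        delta * #|W|%:R ^+ 2 <= #|link_pairs G S|%:R) & ~ Spa R F G].
Proof.
move=> FP Qs /andP[s0 sm] e0 H.
have [N [NN0 N0' cN]] := ex_nat_linear_le c N0 e0.
have V0 : (0 < #|V|)%N by lia.
have [|X Xc] := @ex_set_card (#|V| * N) (s * N).-1; first by nia.
have X1 : #|X|.+1 = (s * N)%N by rewrite Xc prednK // muln_gt0 s0.
exists 'I_(#|V| * N), (space_barrier k j X); rewrite card_ord; split.
- by apply: leq_trans NN0 _; rewrite leq_pmull.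
- exact: dvdn_mulr.
- by move=> S Sk; apply: H.
apply: (@not_Spa_of_small_set _ _ _ _ _ _ X s); last first.
  rewrite card_ord; have -> : (s * (#|V| * N) = s * N * #|V|)%N by ring.
  by rewrite -X1 ltn_pmul2r.
move=> phi /(space_barrier_hom V0 FP)[Q [QP jQ]]; apply: leq_trans; exact: Qs.
Qed.

Lemma uniformity_le_card (k : nat) (V : finType) (F : kgraph k V) (P : {set {set V}}) :
  complete_partite F P -> (k <= #|V|)%N.
Proof.
move=> FP; rewrite -(card_parts FP).
apply: leq_trans (leq_imset_card (pblock P) V); apply: subset_leq_card.
apply/subsetP => C CP; have [x xC] := part_inhabited FP CP.
by apply/imsetP; exists x => //; rewrite (part_pblock FP CP xC).
Qed.

Lemma two_parts_le_sum (V : finType) (P Q : {set {set V}}) (A B : {set V}) :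
  two_smallest_parts P A B -> Q \subset P -> (1 < #|Q|)%N ->
  (#|A| + #|B| <= \sum_(C in Q) #|C|)%N.
Proof.
move=> [AP BP AB cAB min] QP Q2.
have [AQ|AQ] := boolP (A \in Q).
  rewrite (big_setD1 A AQ) /= leq_add2l.
  have /card_gt0P[C CQ] : (0 < #|Q :\ A|)%N by move: Q2; rewrite (cardsD1 A) AQ.
  rewrite (big_setD1 C CQ) /=; move: CQ; rewrite !inE => /andP[CA CQ].
  by apply: leq_trans (leq_addr _ _); apply: min => //; exact: (subsetP QP).
have minQ C : C \in Q -> (#|B| <= #|C|)%N.
  by move=> CQ; apply: min; [exact: (subsetP QP) | apply: contraNneq AQ => <-].
apply: (@leq_trans (\sum_(C in Q) #|B|)); last exact: leq_sum.
by rewrite sum_nat_const; nia.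
Qed.

Lemma Spa_threshold (R : realType) (k : nat) (V : finType) (F : kgraph k V)
    (P : {set {set V}}) (A B : {set V}) :
  (3 <= k)%N -> complete_partite F P -> two_smallest_parts P A B ->
  threshold R (k - 2) #|V| (Spa R F) =
    Num.max (1 - (1 - rel_size R A) ^+ 2) ((rel_size R A + rel_size R B) ^+ 2).
Proof.
move=> k3 FP ABP; have [AP BP AB cAB minB] := ABP.
have PV := parts_partition FP.
have A0 : (0 < #|A|)%N.
  by have [x xA] := part_inhabited FP AP; apply/card_gt0P; exists x.
have ABV : (#|A| + #|B| <= #|V|)%N.
  by rewrite -(sum_card_parts PV AP BP AB) addnA leq_addr.
have AV : (#|A| <= #|V|)%N := leq_trans (leq_addr _ _) ABV.
have V0 : (0 < #|V|)%N := leq_trans A0 AV.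
have kV := uniformity_le_card FP.
have m0 : 0 < #|V|%:R :> R by rewrite ltr0n.
set t1 := rel_size R A; set t2 := rel_size R B.
have t1E : t1 * #|V|%:R = #|A|%:R by rewrite /t1 /rel_size divfK ?gt_eqF.
have t2E : t2 * #|V|%:R = #|B|%:R by rewrite /t2 /rel_size divfK ?gt_eqF.
have t10 : 0 <= t1 by apply: divr_ge0.
have t20 : 0 <= t2 by apply: divr_ge0.
have t12 : t1 + t2 <= 1.
  by rewrite -(ler_pM2r m0) mulrDl t1E t2E mul1r -natrD ler_nat.
apply: threshold_eq; first by lia.
  apply: forcing_of_link_pairs; first by lia.
    by rewrite le_max sqr_ge0 orbT /= ge_max; nra.
  move=> mu mu0; exists (maxn 1 #|V|) => W G; rewrite geq_max => /andP[W0 VW] _ HS.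
  apply: (@Spa_of_link_pairs R k V W F P A B G) => //; first by rewrite kV.
  move=> S Sk; apply: lt_le_trans (HS S Sk); rewrite ltr_pM2r ?ltrDl //.
  by rewrite exprn_gt0 // ltr0n.
move=> delta /andP[delta0]; rewrite lt_max => /orP[dlt|dlt] N0.
  (* Below the first term, take [j = 1]: a whole part, of size at least [#|A|], is mapped into [X].
     Here [e] is the gap to that term, scaled by [#|V| ^ 2]. *)
  apply: (@Spa_space_barrier R k 1 #|A| V F P delta
    (2 * k%:R * #|V|%:R + 2 * #|V|%:R + 1)
    (#|V|%:R ^+ 2 - (#|V|%:R - #|A|%:R) ^+ 2 - delta * #|V|%:R ^+ 2)) => //.
  - move=> Q QP /card_gt0P[C CQ]; rewrite (big_setD1 C CQ) /=.
    apply: leq_trans (leq_addr _ _).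
    have [->//|CA] := eqVneq C A.
    by apply: leq_trans cAB _; apply: minB => //; exact: (subsetP QP).
  - by rewrite A0.
  - rewrite -t1E; have -> : #|V|%:R ^+ 2 - (#|V|%:R - t1 * #|V|%:R) ^+ 2 -
       delta * #|V|%:R ^+ 2 = (1 - (1 - t1) ^+ 2 - delta) * #|V|%:R ^+ 2 by ring.
    by rewrite mulr_gt0 ?exprn_gt0 ?subr_gt0.
  move=> N X S N0' Sk XA h; have := @space_barrier_link1 R k _ X S delta Sk.
  rewrite card_ord; apply; rewrite [(2 * k)%:R]natrM (natrM _ #|V|).
  have -> : #|X|%:R = #|A|%:R * N%:R - 1 :> R by rewrite -natrM -XA -natr1 addrK.
  apply: barrier1_arith => //; first by rewrite (ler_nat R 1).
    by rewrite ler_nat.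
  by rewrite ltr0n.
(* Below the second term, take [j = 2]: two whole parts are mapped into [X]. *)
apply: (@Spa_space_barrier R k 2 (#|A| + #|B|) V F P delta
  (2 * k%:R * #|V|%:R + 2 * (#|A| + #|B|)%:R)
  ((#|A| + #|B|)%:R ^+ 2 - delta * #|V|%:R ^+ 2)) => //.
- by move=> Q; exact: two_parts_le_sum.
- by rewrite ABV addn_gt0 A0.
- rewrite natrD -t1E -t2E -mulrDl exprMn -mulrBl.
  by rewrite mulr_gt0 ?exprn_gt0 ?subr_gt0.
move=> N X S N0' Sk XA h; have := @space_barrier_link2 R k _ X S delta Sk.
rewrite card_ord; apply; rewrite [(2 * k)%:R]natrM (natrM _ #|V|).
have -> : #|X|%:R = (#|A| + #|B|)%:R * N%:R - 1 :> R.
  by rewrite -natrM -XA -natr1 addrK.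
exact: barrier2_arith.
Qed.

(** * Perfect integral tilings *)

Section Colourings.
Variables (k : nat) (V : finType) (F : kgraph k V) (P : {set {set V}}).
Hypotheses (FP : complete_partite F P) (k0 : (0 < k)%N).

Lemma ex_transversal : exists g : {set V} -> V, forall C, C \in P -> g C \in C.
Proof.
have /card_gt0P[C0 C0P] : (0 < #|P|)%N by rewrite (card_parts FP).
have [x0 _] := part_inhabited FP C0P.
exists (fun C : {set V} => odflt x0 [pick z in C]) => C CP.
case: pickP => // noz; have [z zC] := part_inhabited FP CP.
by have := noz z; rewrite zC.
Qed.

(** Two vertices of different parts lie in a common edge. *)
Lemma proper_colouring_parts l (c : {ffun V -> 'I_l}) x y :
  proper_colouring F c -> c x = c y -> pblock P x = pblock P y.
Proof.
move=> cF cxy; apply/eqP; apply: contraT => xy.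
have [g [gP gx gy]] := ex_transversal_through FP xy.
have gE := transversal_edge FP gP.
have := forall_inP cF _ gE => /forallP/(_ (c x)) /card_le1_eqP.
have memg z : g (pblock P z) = z -> z \in g @: P.
  by move=> gz; rewrite -{1}gz imset_f // (pblock_part FP).
move=> /(_ x y); rewrite !inE (memg x gx) (memg y gy) cxy eqxx.
by move=> /(_ isT isT) exy; rewrite exy eqxx in xy.
Qed.

(** An edge needs [k] colours, so it shows every colour, and the class of a colour is the part of
    the vertex that bears it in the edge. *)
Lemma colour_class_part l (c : {ffun V -> 'I_l}) : (l <= k)%N ->
  proper_colouring F c ->
  l = k /\ forall i : 'I_l, [set v | c v == i] \in P.
Proof.
move=> lk cF; have [g gP] := ex_transversal.
have gE := transversal_edge FP gP; set e := g @: P in gE.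
have cinj : {in e &, injective c}.
  move=> x y xe ye /(proper_colouring_parts cF).
  exact: (edge_pblock_inj FP gE).
have ce : #|c @: e| = k by rewrite card_in_imset // (edges_uniform gE).
have kl : (k <= l)%N by rewrite -ce -[X in (_ <= X)%N]card_ord max_card.
have {}lk : l = k by apply/eqP; rewrite eqn_leq lk kl.
have cT : c @: e = setT.
  by apply/eqP; rewrite eqEcard subsetT cardsT card_ord ce lk leqnn.
split=> // i; have : i \in c @: e by rewrite cT inE.
case/imsetP => x xe ->.
have -> : [set v | c v == c x] = pblock P x.
  apply/setP => y; rewrite inE; apply/eqP/idP => [cyx|yx].
    by rewrite -(proper_colouring_parts cF cyx) (mem_pblock_part FP).
  have : c y \in c @: e by rewrite cT inE.
  case/imsetP => z ze cyz; rewrite cyz; congr (c _).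
  apply: (edge_pblock_inj FP gE) => //.
  rewrite -(proper_colouring_parts cF cyz).
  exact: (part_pblock FP (pblock_part FP x) yx).
exact: (pblock_part FP).
Qed.

Lemma chi_le : (chi F <= k)%N.
Proof.
have colk : colourable F #|P|.
  have /card_gt0P[C0 C0P] : (0 < #|P|)%N by rewrite (card_parts FP).
  apply/existsP; exists [ffun x => enum_rank_in C0P (pblock P x)].
  apply/forall_inP => e eF; apply/forallP => i; apply/card_le1_eqP => x y.
  rewrite !inE !ffunE => /andP[xe /eqP <-] /andP[ye /eqP].
  move=> rxy; apply: (edge_pblock_inj FP eF) => //.
  by apply: (can_in_inj (enum_rankK_in C0P)); rewrite ?(pblock_part FP).
by rewrite /chi; case: ex_minnP => l _; apply; rewrite -[X in colourable _ X](card_parts FP).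
Qed.

Lemma colour_diffs_parts m : (1 < k)%N -> m \in colour_diffs F ->
  exists C D, [/\ C \in P, D \in P, C != D & m = `| #|C| - #|D| |%N].
Proof.
move=> k1 /imageP[c]; rewrite inE => cF ->.
have [ek cP] := colour_class_part chi_le cF.
have c0 : (0 < chi F)%N by rewrite ek; exact: ltnW.
have c1 : (1 < chi F)%N by rewrite ek.
exists [set v | c v == Ordinal c0], [set v | c v == Ordinal c1]; split=> //.
apply/eqP => E; have [x] := part_inhabited FP (cP (Ordinal c0)).
move=> /[dup]; rewrite {1}E !inE => /eqP-> /eqP/(congr1 val) //.
Qed.

Lemma gcd_big_closed (s : seq nat) (D : nat -> Prop) :
  D 0%N -> (forall a b, D a -> D b -> D (gcdn a b)) ->
  (forall m, m \in s -> D m) -> D (\big[gcdn/0%N]_(m <- s | m != 0%N) m).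
Proof.
move=> D0 Dg Ds; rewrite big_seq_cond.
by apply: (big_rec D) => // m a /andP[/Ds Dm _] Da; apply: Dg.
Qed.

End Colourings.

(** * The lattice of homomorphisms *)

Section Span.
Variables (k : nat) (V W : finType) (F : kgraph k V) (G : kgraph k W).

(** Membership in the lattice generated by the vectors of preimage sizes of the homomorphisms. *)
Definition hom_span (f : W -> int) : Prop :=
  exists w : {ffun V -> W} -> int, forall v,
    \sum_(phi in homs F G) w phi * #|phi @^-1: [set v]|%:R = f v.

Lemma hom_span_ext f g : f =1 g -> hom_span f -> hom_span g.
Proof. by move=> fg [w wf]; exists w => v; rewrite wf. Qed.

Lemma hom_span_lin a f g : hom_span f -> hom_span g -> hom_span (fun v => a * f v + g v).
Proof.
move=> [w wf] [w' wg]; exists (fun phi => a * w phi + w' phi) => v.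
rewrite -wf -wg mulr_sumr -big_split; apply: eq_bigr => phi _ /=; ring.
Qed.

Lemma hom_span0 : hom_span (fun=> 0).
Proof. by exists (fun=> 0) => v; rewrite big1 // => phi _; rewrite mul0r. Qed.

Lemma hom_spanZ a f : hom_span f -> hom_span (fun v => a * f v).
Proof.
by move=> sf; apply: hom_span_ext (hom_span_lin a sf hom_span0) => v; rewrite addr0.
Qed.

Lemma hom_span_hom phi : phi \in homs F G ->
  hom_span (fun v => #|phi @^-1: [set v]|%:R).
Proof.
move=> phiH; exists (fun psi => (psi == phi)%:R) => v.
rewrite (bigD1 phi) //= eqxx mul1r big1 ?addr0 // => psi /andP[_ /negPf->].
by rewrite mul0r.
Qed.

Lemma hom_span_sum (a : W -> int) (f : W -> W -> int) :
  (forall u, hom_span (f u)) -> hom_span (fun v => \sum_u a u * f u v).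
Proof.
move=> sf; elim: (index_enum W) => [|u r IH].
  by apply: hom_span_ext hom_span0 => v; rewrite big_nil.
by apply: hom_span_ext (hom_span_lin (a u) (sf u) IH) => v; rewrite big_cons.
Qed.

Definition transfer (d : int) (u v : W) : Prop :=
  hom_span (fun w => d * ((w == u)%:R - (w == v)%:R)).

Lemma transfer_trans u v w : transfer 1 u v -> transfer 1 v w -> transfer 1 u w.
Proof.
move=> uv vw; apply: hom_span_ext (hom_span_lin 1 uv vw) => x; ring.
Qed.

Lemma transfer_refl d u : transfer d u u.
Proof. by apply: hom_span_ext hom_span0 => x; rewrite subrr mulr0. Qed.

Lemma transfer_gcdn (a b : nat) u v :
  transfer a u v -> transfer b u v -> transfer (gcdn a b) u v.
Proof.
move=> ta tb; have [x [y E]] := Bezoutz a b.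
apply: hom_span_ext (hom_span_lin x ta (hom_spanZ y tb)) => w /=.
by rewrite !mulrA -mulrDl E.
Qed.

Lemma Div_of_span (R : realType) : hom_span (fun=> 1) -> Div R F G.
Proof.
move=> [w w1]; exists (fun phi => (w phi)%:~R); split; last by move=> phi _; exact: intr_int.
move=> v; have := congr1 (fun x : int => x%:~R : R) (w1 v).
rewrite /= rmorph_sum /= => H; apply: etrans (etrans H (mulr1z 1)).
apply: eq_bigr => phi _; by rewrite rmorphM /= rmorph_nat.
Qed.

Variable P : {set {set V}}.
Hypothesis FP : complete_partite F P.

Lemma card_preim_pblock (s : {set V} -> W) w :
  #|[ffun x => s (pblock P x)] @^-1: [set w]|%:R =
    \sum_(C in P) (w == s C)%:R *+ #|C| :> int.
Proof.
rewrite -(sum_pblock (fun C => (w == s C)%:R) (parts_partition FP)).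
rewrite -sum1_card natr_sum big_mkcond; apply: eq_bigr => x _.
by rewrite !inE ffunE eq_sym; case: (_ == _).
Qed.

(* The difference of two homomorphisms onto [e] that differ by exchanging the
   images of [C] and [D]. *)
Lemma transfer_edge e u v C D : e \in edges G -> u \in e -> v \in e -> u != v ->
  C \in P -> D \in P -> C != D -> transfer (#|C|%:Z - #|D|%:Z) u v.
Proof.
move=> eG ue ve uv CP DP CD.
pose S := e :\ u :\ v.
have vS : v \in e :\ u by rewrite !inE eq_sym uv.
have eE : u |: (v |: S) = e by rewrite /S setD1K // setD1K.
have Sk : #|P| = #|S|.+2.
  by rewrite (card_parts FP) -(edges_uniform eG) (cardsD1 u) ue (cardsD1 v) vS.
have uS : u \notin S by rewrite !inE eqxx andbF.
have vS' : v \notin S by rewrite !inE eqxx.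
have [s [sC sD sP sR]] := ex_imset_eq2 CP DP CD uS vS' uv Sk.
pose t E := if E == C then v else if E == D then u else s E.
have tC : t C = v by rewrite /t eqxx.
have tD : t D = u by rewrite /t eq_sym (negPf CD) eqxx.
have tE E : E != C -> E != D -> t E = s E by rewrite /t => /negPf-> /negPf->.
have DPC : D \in P :\ C by rewrite !inE eq_sym CD.
have tR : t @: (P :\ C :\ D) = S.
  by rewrite -sR; apply: eq_in_imset => E; rewrite !inE => /and3P[ED EC _]; exact: tE.
have tP : t @: P \in edges G.
  by rewrite -(setD1K CP) -(setD1K DPC) !imsetU !imset_set1 tR tC tD setUCA eE.
rewrite eE in sP; rewrite -sP in eG.
have hs := hom_span_hom (hom_pblock FP eG); have ht := hom_span_hom (hom_pblock FP tP).
apply: hom_span_ext (hom_span_lin (-1) ht hs) => w.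
rewrite !card_preim_pblock (big_setD1 C CP) /= (big_setD1 D DPC) /= tC tD.
rewrite [\sum_(C in P) _](big_setD1 C CP) /= [X in _ + (_ + X)](big_setD1 D DPC) /= sC sD.
rewrite (eq_bigr (fun E => (w == s E)%:R *+ #|E|)); last first.
  by move=> E; rewrite !inE => /and3P[ED EC _]; rewrite tE.
have natE (x : int) n : x *+ n = n%:Z * x by rewrite -mulr_natl natz.
rewrite !natE; ring.
Qed.

(** Moving all the weight of one homomorphism to [v0] gives [#|V|] times the unit vector there. A
    multiple of it has total [#|W|], by divisibility, and can be spread evenly over all vertices. *)
Lemma span_of_transfer (v0 : W) : (0 < k)%N -> (#|V| %| #|W|)%N -> edges G != set0 ->
  (forall u, transfer 1 u v0) -> hom_span (fun=> 1).
Proof.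
move=> k0 /dvdnP[q Wq] /set0Pn[e eG] H.
have [s sP] : exists s : {set V} -> W, s @: P = e.
  by apply: (ex_imset_eq v0); rewrite (card_parts FP) (edges_uniform eG).
rewrite -sP in eG; have hs := hom_span_hom (hom_pblock FP eG).
set phi := [ffun x => _] in hs.
have delta_sum (f : W -> int) v :
    \sum_u f u * ((v == u)%:R - (v == v0)%:R) = f v - (\sum_u f u) * (v == v0)%:R.
  under eq_bigr do rewrite mulrBr.
  rewrite sumrB mulr_suml; congr (_ - _).
  rewrite (bigD1 v) //= eqxx mulr1 big1 ?addr0 // => u uv.
  by rewrite eq_sym (negPf uv) mulr0.
have T u : hom_span (fun v => (v == u)%:R - (v == v0)%:R).
  by apply: hom_span_ext (H u) => v; rewrite mul1r.
have mv0 : hom_span (fun v => #|V|%:R * (v == v0)%:R).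
  apply: hom_span_ext (hom_span_lin (-1) (hom_span_sum
     (fun u => #|phi @^-1: [set u]|%:R) T) hs) => v.
  rewrite delta_sum; have -> : \sum_u #|phi @^-1: [set u]|%:R = #|V|%:R :> int.
    transitivity (\sum_u 1 * #|phi @^-1: [set u]|%:R : int).
      by apply: eq_bigr => u _; rewrite mul1r.
    by rewrite (sum_preim phi (fun=> 1)) sumr_const.
  ring.
apply: hom_span_ext (hom_span_lin q%:R mv0 (hom_span_sum (fun=> 1) T)) => v.
rewrite delta_sum sumr_const mulrA -natrM -Wq; ring.
Qed.

End Span.

Lemma transfer_of_gcd (k : nat) (V W : finType) (F : kgraph k V) (G : kgraph k W)
    (P : {set {set V}}) e u v :
  complete_partite F P -> (1 < k)%N -> gcdF F = Some 1%N ->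
  e \in edges G -> u \in e -> v \in e -> transfer F G 1 u v.
Proof.
move=> FP k1; rewrite /gcdF; case: ifP => // _ [g1] eG ue ve.
have [->|uv] := eqVneq u v; first exact: transfer_refl.
have -> : 1 = (1%N : int) by [].
rewrite -g1; apply: (@gcd_big_closed _ (fun m : nat => transfer F G m u v)).
- by apply: hom_span_ext (hom_span0 F G) => w; rewrite mul0r.
- by move=> a b; exact: transfer_gcdn.
move=> m /(colour_diffs_parts FP (ltnW k1) k1)[C [D [CP DP CD ->]]].
have T := transfer_edge FP eG ue ve uv CP DP CD.
(* The sign accounts for the absolute value in [colour_diff]. *)
apply: hom_span_ext (hom_spanZ (Num.sg (#|C|%:Z - #|D|%:Z)) T) => w.
by rewrite mulrA -normrEsg abszE.
Qed.

Section DivThreshold.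
Variables (R : realType) (k : nat) (V : finType) (F : kgraph k V) (P : {set {set V}}).
Hypotheses (k3 : (3 <= k)%N) (FP : complete_partite F P).

(** For [k >= 4] any two vertices fit into a set of [k - 2], so nonempty link graphs already put
    them in a common edge. *)
Lemma Div_of_link_pairs4 (W : finType) (G : kgraph k W) :
  gcdF F = Some 1%N -> (4 <= k <= #|W|)%N -> (#|V| %| #|W|)%N ->
  (forall S : {set W}, #|S|.+2 = k -> (0 < #|link_pairs G S|)%N) ->
  Div R F G.
Proof.
move=> gF /andP[k4 kW] VW HS.
have edge2 u v : exists e, [/\ e \in edges G, u \in e & v \in e].
  have [|S uvS Sk] := @ex_superset_card W [set u; v] (k - 2).
    rewrite cards2 (leq_trans (leq_subr _ _) kW) andbT.
    by case: (u != v); lia.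
  have /card_gt0P[[a b] abG] : (0 < #|link_pairs G S|)%N by apply: HS; lia.
  exists (a |: (b |: S)); split; first by move: abG; rewrite inE.
    by rewrite !inE (subsetP uvS) ?orbT // !inE eqxx.
  by rewrite !inE (subsetP uvS) ?orbT // !inE eqxx orbT.
have /card_gt0P[v0 _] : (0 < #|W|)%N by apply: leq_trans kW; exact: ltnW (ltnW (ltnW k4)).
apply: Div_of_span; apply: (span_of_transfer FP (v0 := v0)) => //; first by lia.
  by have [e [eG _ _]] := edge2 v0 v0; apply/set0Pn; exists e.
move=> u; have [e [eG ue ve]] := edge2 u v0.
by apply: transfer_of_gcd FP _ gF eG ue ve; lia.
Qed.

(** The link graph of [u] lives on [N u], which thus contains more than half of the vertices. Any
    two such sets intersect, and a common element joins [u] to [v0] through two edges. *)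
Lemma Div_of_link_pairs3 (W : finType) (G : kgraph k W) :
  gcdF F = Some 1%N -> k = 3%N -> (0 < #|W|)%N -> (#|V| %| #|W|)%N ->
  (forall S : {set W}, #|S|.+2 = k -> (#|W| ^ 2 < 4 * #|link_pairs G S|)%N) ->
  Div R F G.
Proof.
move=> gF kE W0 VW HS.
pose N u := [set x | [exists e in edges G, (u \in e) && (x \in e)]].
have NW u : (#|W| < 2 * #|N u|)%N.
  have := HS [set u]; rewrite cards1 => /(_ (esym kE)).
  have : (#|link_pairs G [set u]| <= #|N u| * #|N u|)%N.
    rewrite -cardsX; apply: subset_leq_card; apply/subsetP => -[a b].
    rewrite inE in_setX /= => abG; rewrite !inE.
    by apply/andP; split; apply/existsP; exists (a |: (b |: [set u]));
      rewrite abG !inE !eqxx ?orbT.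
  by move: #|N u| #|link_pairs _ _| #|W| => x y z; nia.
have /card_gt0P[v0 _] := W0.
have Tedge e u v := @transfer_of_gcd k V W F G P e u v FP (ltnW k3) gF.
apply: Div_of_span; apply: (span_of_transfer FP (v0 := v0)) => //; first by lia.
  have /card_gt0P[x] : (0 < #|N v0|)%N by move: (NW v0); lia.
  by rewrite inE => /exists_inP[e eG _]; apply/set0Pn; exists e.
move=> u; have /card_gt0P[x] : (0 < #|N u :&: N v0|)%N.
  have UW : (#|N u :|: N v0| <= #|W|)%N by exact: max_card.
  move: UW (cardsUI (N u) (N v0)) (NW u) (NW v0).
  by move: #|N u :|: _| #|N u :&: _| #|N u| #|N v0| #|W| => p q r s n; lia.
rewrite !inE => /andP[/exists_inP[e eG /andP[ue xe]] /exists_inP[f fG /andP[vf xf]]].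
exact: transfer_trans (Tedge _ _ _ eG ue xe) (Tedge _ _ _ fG xf vf).
Qed.

(** * The divisibility barrier of two disjoint cliques *)

Lemma two_cliques_uniform (W : finType) (X : {set W}) e :
  e \in [set e : {set W} | (#|e| == k) && ((e \subset X) || (e \subset ~: X))] ->
  #|e| = k.
Proof. by rewrite inE => /andP[/eqP]. Qed.

Definition two_cliques (W : finType) (X : {set W}) : kgraph k W :=
  KGraph (@two_cliques_uniform W X).

(** Vertices of different parts share an edge and go to the same side; vertices of one part are
    compared through a vertex of another. So the preimage of [X] is empty or everything. *)
Lemma two_cliques_hom (W : finType) (X : {set W}) (phi : {ffun V -> W}) :
  phi \in homs F (two_cliques X) -> (#|V| %| #|phi @^-1: X|)%N.
Proof.
rewrite inE => /forall_inP phiE.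
have other x y : pblock P x != pblock P y -> (phi x \in X) = (phi y \in X).
  move=> xy; have [g [gP gx gy]] := ex_transversal_through FP xy.
  have mem z : g (pblock P z) = z -> phi z \in phi @: (g @: P).
    by move=> gz; rewrite -{1}gz !imset_f // (pblock_part FP).
  have := phiE _ (transversal_edge FP gP); rewrite inE => /andP[_].
  move=> /orP[] /subsetP eX; move: (eX _ (mem x gx)) (eX _ (mem y gy)).
    by move=> -> ->.
  by rewrite !inE => /negPf-> /negPf->.
have same x y : (phi x \in X) = (phi y \in X).
  have [xy|] := eqVneq (pblock P x) (pblock P y); last exact: other.
  have /card_gt0P[C] : (0 < #|P :\ pblock P x|)%N.
    have := cardsD1 (pblock P x) P; rewrite (pblock_part FP) (card_parts FP) add1n => E.
    by rewrite -ltnS -E ltnW.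
  rewrite !inE => /andP[Cx CP]; have [z zC] := part_inhabited FP CP.
  have zE := part_pblock FP CP zC.
  by rewrite (other x z) ?(other y z) ?zE 1?eq_sym // -xy.
have [|] := set_0Vmem (phi @^-1: X); first by move->; rewrite cards0.
case=> x; rewrite inE => xX; suff -> : phi @^-1: X = setT by rewrite cardsT.
by apply/setP => y; rewrite !inE (same y x) xX.
Qed.

Lemma two_cliques_not_Div (W : finType) (X : {set W}) :
  ~~ (#|V| %| #|X|)%N -> ~ Div R F (two_cliques X).
Proof.
move=> /negP ndiv [w [wT wint]]; apply: ndiv; have := tiling_sum X wT.
have -> : \sum_(phi in homs F (two_cliques X)) w phi * #|phi @^-1: X|%:R =
  (\sum_(phi in homs F (two_cliques X)) w phi * (#|phi @^-1: X| %/ #|V|)%:R) * #|V|%:R.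
  rewrite mulr_suml; apply: eq_bigr => phi phiH; rewrite -mulrA -natrM divnK //.
  exact: two_cliques_hom.
set z := \sum_(phi in _) _; have : z \is a Num.int.
  by apply: rpred_sum => phi phiH; apply: rpredM; [exact: wint | exact: rpred_nat].
move=> /intrP[i ->]; rewrite !pmulrn -intrM => /eqP; rewrite eqr_int => /eqP E.
have : (#|V|%:Z %| #|X|%:Z)%Z by rewrite -E dvdz_mull.
by [].
Qed.

(** All pairs on the side containing the single vertex of [S] count; [6] is the [2 * k] of
    [card_le_link_pairs]. *)
Lemma two_cliques_link (W : finType) (X : {set W}) (delta : R) (x : nat) (S : {set W}) :
  k = 3%N -> #|S|.+2 = k -> (x <= #|X|)%N -> (x <= #|~: X|)%N ->
  delta * #|W|%:R ^+ 2 + 6 * #|W|%:R <= x%:R ^+ 2 ->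
  delta * #|W|%:R ^+ 2 <= #|link_pairs (two_cliques X) S|%:R.
Proof.
move=> kE Sk xX xXC h.
have /cards1P[s sE] : #|S| == 1%N by rewrite -2!eqSS Sk kE.
have [Y [sY xY YX]] : exists Y : {set W}, [/\ s \in Y, (x <= #|Y|)%N & Y = X \/ Y = ~: X].
  by have [sX|sX] := boolP (s \in X); [exists X | exists (~: X)]; split=> //;
    [left | rewrite inE | right].
have TG a b : (a, b) \in setX Y Y -> a != b ->
    a \notin S -> b \notin S -> a |: (b |: S) \in edges (two_cliques X).
  rewrite in_setX => /andP[aX bX] ab aS bS.
  rewrite inE (card_setU2 Sk) // eqxx /=.
  have sub : a |: (b |: S) \subset Y by rewrite sE !subUset !sub1set aX bX sY.
  by case: YX => <-; rewrite sub ?orbT.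
have := card_le_link_pairs Sk TG.
have xx : (x * x <= #|Y| * #|Y|)%N by apply: leq_mul.
rewrite cardsX => /(leq_trans xx); rewrite -(ler_nat R) natrD !natrM.
have kR : k%:R = 3 :> R by rewrite kE.
rewrite kR; lra.
Qed.

End DivThreshold.

Lemma Div_threshold (R : realType) (k : nat) (V : finType) (F : kgraph k V)
    (P : {set {set V}}) :
  (3 <= k)%N -> complete_partite F P -> gcdF F = Some 1%N ->
  threshold R (k - 2) #|V| (Div R F) = if k == 3%N then 4%:R^-1 else 0.
Proof.
move=> k3 FP gF; have kV := uniformity_le_card FP.
have pos_of_link (W : finType) (G : kgraph k W) (mu : R) S : 0 < mu -> (0 < #|W|)%N ->
    mu * #|W|%:R ^+ 2 <= #|link_pairs G S|%:R -> (0 < #|link_pairs G S|)%N.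
  move=> mu0 W0 h; rewrite -(ltr_nat R); apply: lt_le_trans h.
  by rewrite mulr_gt0 // exprn_gt0 // ltr0n.
have [kE|kE] := eqVneq k 3%N; last first.
  apply: threshold_eq; [by lia | | by move=> delta; lra].
  apply: forcing_of_link_pairs; [by lia | by rewrite lexx ler01 |].
  move=> mu mu0; exists k => W G kW VW HS; apply: (Div_of_link_pairs4 R k3 FP) => //.
    by rewrite kW andbT; lia.
  move=> S Sk; apply: (pos_of_link W G mu) => //; first by lia.
  by have := HS S Sk; rewrite add0r.
apply: threshold_eq; first by lia.
  apply: forcing_of_link_pairs; [by lia | lra |].
  move=> mu mu0; exists 1%N => W G W0 VW HS; apply: (Div_of_link_pairs3 R k3 FP) => //.
  move=> S Sk; rewrite -(ltr_nat R) natrM natrX.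
  have n0 : 0 < #|W|%:R ^+ 2 :> R by rewrite exprn_gt0 // ltr0n.
  have := HS S Sk; have := mulr_gt0 mu0 n0; lra.
move=> delta /andP[delta0 delta1] N0; clear gF.
have e0 : 0 < (1 - 4 * delta) * #|V|%:R ^+ 2.
  apply: mulr_gt0; first by lra.
  by rewrite exprn_gt0 // ltr0n; apply: leq_trans kV; exact: ltnW (ltnW k3).
(* The cliques will have [#|V| M + 1] and [#|V| M - 1] vertices. The constant 14 is 12, from the
   pairs lost in [two_cliques_link], plus 2, from the square of [#|V| M - 1]. *)
have [M [MN M0 HM]] := ex_nat_linear_le (14 * #|V|%:R) N0 e0.
have V0 : (0 < #|V|)%N by lia.
have [|X Xc] := @ex_set_card (2 * (#|V| * M)) (#|V| * M).+1; first by nia.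
exists 'I_(2 * (#|V| * M)), (two_cliques k X); rewrite card_ord; split.
- by nia.
- by rewrite dvdn_mull // dvdn_mulr.
- move=> S Sk; have := @two_cliques_link R k _ X delta (#|V| * M).-1 S kE Sk.
  rewrite Xc cardsCs setCK card_ord Xc; apply; [by lia | by lia |].
  rewrite -subn1 natrB; last by rewrite muln_gt0 V0.
  by rewrite !natrM; lra.
apply: (two_cliques_not_Div k3 FP); rewrite Xc -addn1 dvdn_addr ?dvdn_mulr //.
by rewrite dvdn1; lia.
Qed.

(** * Covers *)

Lemma ex_imset_eq1 (T W : finType) (X : {set T}) (Y : {set W}) (A : T) (a : W) :
  A \in X -> #|X| = #|Y|.+1 ->
  exists f : T -> W, f A = a /\ f @: (X :\ A) = Y.
Proof.
move=> AX XY; have [|f fXY] := @ex_imset_eq T W a (X :\ A) Y.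
  by apply/eqP; rewrite -eqSS -XY (cardsD1 A X) AX.
exists (fun t => if t == A then a else f t); rewrite eqxx; split=> //.
by rewrite -fXY; apply: eq_in_imset => t; rewrite !inE => /andP[/negPf->].
Qed.

Lemma card_pairs_fst_le (W : finType) (L : {set W * W}) (N : {set W}) (d : nat) :
  (forall a, a \in N -> (#|[set b | (a, b) \in L]| <= d)%N) ->
  (#|[set p in L | p.1 \in N]| <= #|N| * d)%N.
Proof.
move=> Hd; rewrite -sum_nat_const -sum1_card.
rewrite (partition_big fst (mem N)) /=; last by move=> p; rewrite inE => /andP[].
apply: leq_sum => a aN; rewrite sum1_card; apply: leq_trans (Hd a aN).
apply: leq_trans (leq_imset_card (pair a) [set b | (a, b) \in L]).
apply: subset_leq_card; apply/subsetP => -[a' b].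
rewrite unfold_in /= inE => /andP[/andP[abL _] /eqP aa]; rewrite /= in aa abL.
by rewrite -aa; apply/imsetP; exists b; rewrite // inE.
Qed.

(* [u] is a vertex of maximal degree [d] in the link graph [L] of an uncovered
   vertex [v]: no pair of [L] extends to an edge by a vertex other than [v], so
   the link of [u] avoids [L] and, up to pairs containing [v], also avoids the
   neighbourhood of [u] in [L]. *)
Lemma uncovered_link_bounds (k : nat) (W : finType) (G : kgraph k W)
    (v : W) (T : {set W}) :
  #|T|.+3 = k -> v \notin T ->
  (forall a b w, v |: (a |: (b |: T)) \in edges G ->
     w |: (a |: (b |: T)) \in edges G -> w = v) ->
  (0 < #|link_pairs G (v |: T)|)%N ->
  exists (u : W) (d : nat), [/\ u \notin T, (d <= #|W|)%N,
    (#|link_pairs G (v |: T)| <= #|W| * d)%N,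
    (#|link_pairs G (u |: T)| <= (#|W| - d) ^ 2 + 2 * #|W|)%N &
    (#|link_pairs G (u |: T)| + #|link_pairs G (v |: T)| <=
       (#|W| - d) ^ 2 + 2 * d ^ 2 + 2 * #|W|)%N].
Proof.
move=> Tk vT twin; set L := link_pairs G (v |: T) => /card_gt0P[[a0 b0] abL0].
have vTk : #|v |: T|.+2 = k by rewrite cardsU1 vT -Tk.
have rot a b c : a |: (b |: (c |: T)) = c |: (a |: (b |: T)).
  by rewrite (setUCA [set b]) (setUCA [set a]).
have inL a b : ((a, b) \in L) = (v |: (a |: (b |: T)) \in edges G).
  by rewrite inE /= rot.
have Lsym a b : ((a, b) \in L) = ((b, a) \in L).
  by rewrite !inL (setUCA [set a]).
pose deg a := #|[set b | (a, b) \in L]|.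
pose u := [arg max_(x > a0) deg x]%N; set N := [set b | (u, b) \in L].
have umax a : (deg a <= deg u)%N.
  by rewrite /u; case: arg_maxnP => // i _ /(_ a); apply.
have dpos : (0 < deg u)%N.
  by apply: leq_trans (umax a0); apply/card_gt0P; exists b0; rewrite inE.
have [b1] : exists b, b \in N by apply/card_gt0P.
rewrite inE => ub1; have [_ uvT _] := link_pair_spec vTk ub1.
move: uvT; rewrite !inE negb_or => /andP[uv uT].
set M := link_pairs G (u |: T).
have inM a b : ((a, b) \in M) = (u |: (a |: (b |: T)) \in edges G).
  by rewrite inE /= rot.
pose NC := setX (~: N) (~: N); pose VV := setX [set v] [set: W] :|: setX [set: W] [set v].
have cVV : (#|VV| <= 2 * #|W|)%N.
  apply: leq_trans (leq_card_setU _ _).1 _.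
  by rewrite !cardsX !cards1 cardsT mul1n muln1 mul2n addnn.
have cNC : #|NC| = ((#|W| - deg u) ^ 2)%N.
  by rewrite cardsX -mulnn [#|~: N|]cardsCs setCK.
(* If a pair [(a, b)] of [M] had [a] in [N], both [v] and [b] would extend [u |: (a |: T)] to an
   edge, forcing [b = v]. Hence the pairs through [v] are set apart in [VV]. *)
have MS : M \subset (NC :\: L) :|: VV.
  apply/subsetP => -[a b]; rewrite inM => abM.
  rewrite !in_setU in_setD !in_setX !in_setC !in_setT !in_set1 andbT /=.
  have [av|av] := eqVneq a v; first by rewrite orbT.
  have [bv|bv] := eqVneq b v; first by rewrite !orbT.
  have abL : (a, b) \notin L.
    by rewrite inL; apply/negP => /twin/(_ abM)/eqP; rewrite (negPf uv).
  have aN : a \notin N.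
    rewrite inE inL; apply/negP => h.
    have abM' : b |: (u |: (a |: T)) \in edges G by rewrite -rot.
    by have /eqP := twin _ _ _ h abM'; rewrite (negPf bv).
  have bN : b \notin N.
    rewrite inE inL; apply/negP => h.
    have abM' : a |: (u |: (b |: T)) \in edges G by rewrite (setUCA [set a]).
    by have /eqP := twin _ _ _ h abM'; rewrite (negPf av).
  by rewrite abL aN bN.
have L12 : [set p in L | p.1 \in [set: W]] = L.
  by apply/setP => p; rewrite in_set in_setT andbT.
exists u, (deg u); split=> //; first exact: max_card.
- by rewrite -{1}L12 -cardsT; apply: card_pairs_fst_le => a _; exact: umax.
- apply: leq_trans (subset_leq_card MS) _; apply: leq_trans (leq_card_setU _ _).1 _.
  by rewrite leq_add // -cNC subset_leq_card // subsetDl.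
pose L1 := [set p in L | p.1 \in N]; pose L2 := [set p in L | p.2 \in N].
have cL1 : (#|L1| <= deg u ^ 2)%N.
  by rewrite -mulnn; apply: card_pairs_fst_le => a _; exact: umax.
have cL2 : (#|L2| <= #|L1|)%N.
  apply: leq_trans (leq_imset_card (fun p => (p.2, p.1)) L1).
  apply: subset_leq_card; apply/subsetP => -[a b]; rewrite inE /= => /andP[abL bN].
  by apply/imsetP; exists (b, a); rewrite // inE /= -Lsym abL.
(* At most [2 d ^ 2] pairs of [L] have an end in [N]; the others compete with [M] for the pairs of
   [NC]. *)
have LS : L \subset (NC :&: L) :|: (L1 :|: L2).
  apply/subsetP => -[a b] pL; set p := (a, b) in pL *.
  have pL1 : (p \in L1) = (p.1 \in N) by rewrite in_set pL.
  have pL2 : (p \in L2) = (p.2 \in N) by rewrite in_set pL.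
  rewrite !in_setU in_setI pL1 pL2 pL andbT in_setX !in_setC /=.
  by case: (a \in N); case: (b \in N).
have hM := leq_trans (subset_leq_card MS) (leq_card_setU _ _).1.
have hL := leq_trans (subset_leq_card LS) (leq_card_setU _ _).1.
have hL12 : (#|L1 :|: L2| <= #|L1| + #|L2|)%N := (leq_card_setU _ _).1.
have := cardsID L NC; rewrite cNC => hNC.
move: hM hL hL12 hNC cL1 cL2 cVV.
move: #|M| #|L| #|NC :\: L| #|NC :&: L| #|VV| #|L1 :|: L2| #|L1| #|L2|.
move: (deg u ^ 2)%N ((_ - _) ^ 2)%N (2 * _)%N => *; lia.
Qed.

Lemma card_setU3 (W : finType) (T : {set W}) v a b :
  #|v |: (a |: (b |: T))| = #|T|.+3 -> #|a |: (b |: T)|.+1 = #|T|.+3.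
Proof.
rewrite !cardsU1; move: #|T| => t.
by do 3![case: (_ \notin _)]; rewrite ?add1n ?add0n; lia.
Qed.

Section Covering.
Variables (k : nat) (V : finType) (F : kgraph k V) (P : {set {set V}}).
Hypotheses (k3 : (3 <= k)%N) (FP : complete_partite F P).
Variables (W : finType) (G : kgraph k W).

(** One vertex [x0] of a part goes to [v], the rest of that part to [v'] and the other parts onto
    [e]. Every edge of [F] is then mapped to [v |: e] or to [v' |: e]. *)
Lemma hom_singleton_of_twins v v' (e : {set W}) :
  v != v' -> v |: e \in edges G -> v' |: e \in edges G -> #|e|.+1 = k ->
  exists2 phi, phi \in homs F G & #|phi @^-1: [set v]| = 1%N.
Proof.
move=> vv' veG veG' ek.
have /card_gt0P[A AP] : (0 < #|P|)%N by rewrite (card_parts FP) (leq_trans _ k3).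
have [x0 x0A] := part_inhabited FP AP.
have x0P := part_pblock FP AP x0A.
have [|s [sA sP]] := @ex_imset_eq1 _ W P e A v AP; first by rewrite (card_parts FP).
have ve : v \notin e.
  have := edges_uniform veG; rewrite cardsU1 -ek.
  by case: (v \in e) => //=; rewrite add0n => /n_Sn.
pose s' C := if C == A then v' else s C.
have s'P : s' @: (P :\ A) = e.
  by rewrite -sP; apply: eq_in_imset => C; rewrite !inE /s' => /andP[/negPf->].
pose phi := [ffun x => if x == x0 then v else s' (pblock P x)].
have imP (t : {set V} -> W) (e' : {set V}) : e' \in edges F ->
    {in e', forall x, phi x = t (pblock P x)} -> phi @: e' = t A |: t @: (P :\ A).
  move=> eF' phiE; rewrite (eq_in_imset phiE) (imset_comp t) (edge_pblock_imset FP eF').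
  by rewrite -{1}(setD1K AP) imsetU imset_set1.
exists phi.
  rewrite inE; apply/forall_inP => e' eF'; have [x0e|x0e] := boolP (x0 \in e').
    rewrite (imP s) ?sA ?sP // => x xe; rewrite ffunE /s'.
    case: eqP => [->|xx0]; first by rewrite x0P.
    case: eqP => // xA; case: xx0; apply: (edge_pblock_inj FP eF') => //.
    by rewrite xA x0P.
  rewrite (imP s') // ?s'P /s' ?eqxx // => x xe; rewrite ffunE /s'.
  by case: eqP xe x0e => // -> ->.
apply/eqP/cards1P; exists x0; apply/setP => x; rewrite !inE ffunE.
case: (x == x0); rewrite ?eqxx // /s'; have [_|xA] := eqVneq (pblock P x) A.
  by rewrite eq_sym (negPf vv').
apply/eqP => sv; move: ve; rewrite -sv -sP imset_f // !inE xA.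
exact: (pblock_part FP).
Qed.

(** A singleton colour class is a part; in an edge through [v] it is sent to [v] and the other parts
    to the other vertices. *)
Lemma Cov_of_cone : cone F -> (k <= #|W|)%N ->
  (forall S : {set W}, #|S|.+2 = k -> (0 < #|link_pairs G S|)%N) -> Cov F G.
Proof.
move=> /existsP[c /andP[cF /existsP[i /cards1P[x0 ix0]]]] kW HS v.
have k0 : (0 < k)%N := ltnW (ltnW k3).
have [_ /(_ i)] := colour_class_part FP k0 (leqnn k) cF.
have -> : [set v | c v == i] = [set x0].
  by rewrite -ix0; apply/setP => x; rewrite !inE.
move=> x0P.
have [|S vS Sk] := @ex_superset_card W [set v] (k - 2).
  by rewrite cards1 (leq_trans (leq_subr _ _) kW) andbT subn_gt0.
have /card_gt0P[[a b] abG] : (0 < #|link_pairs G S|)%N by apply: HS; lia.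
pose e := a |: (b |: S).
have eG : e \in edges G by move: abG; rewrite inE.
have ve : v \in e by rewrite !inE (subsetP vS) ?orbT // inE.
have [|s [sv sP]] := @ex_imset_eq1 _ W P (e :\ v) [set x0] v x0P.
  by rewrite (card_parts FP) -(edges_uniform eG) (cardsD1 v) ve.
have sG : s @: P \in edges G.
  by rewrite -(setD1K x0P) imsetU imset_set1 sv sP setD1K.
exists [ffun x => s (pblock P x)]; first exact: (hom_pblock FP sG).
apply/eqP/cards1P; exists x0; apply/setP => x; rewrite !inE ffunE.
apply/eqP/eqP => [sxv|->]; last by rewrite (part_pblock FP x0P) ?sv // inE.
have [E|xx0] := eqVneq (pblock P x) [set x0].
  by have := mem_pblock_part FP x; rewrite E inE => /eqP.
have : s (pblock P x) \in e :\ v.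
  by rewrite -sP imset_f // !inE xx0 (pblock_part FP).
by rewrite sxv !inE eqxx.
Qed.

End Covering.

(* With [x = d / n] the last two bounds read (1 - x)^2 and ((1 - x)^2 + 2 x^2) / 2;
   they cross at [x = s = sqrt 2 - 1], where both equal 2 s^2. *)
Lemma cover_arith (R : realFieldType) (s mu n d : R) :
  0 < s -> s <= 4 / 9 -> s ^+ 2 = 1 - 2 * s -> 0 < n -> d <= n -> 2 < mu * n ->
  (2 * s ^+ 2 + mu) * n ^+ 2 <= n * d ->
  (2 * s ^+ 2 + mu) * n ^+ 2 <= (n - d) ^+ 2 + 2 * n ->
  2 * ((2 * s ^+ 2 + mu) * n ^+ 2) <= (n - d) ^+ 2 + 2 * d ^+ 2 + 2 * n -> False.
Proof.
move=> s0 s4 sE n0 dn mun h1 h2 h3.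
have mun2 : 2 * n < mu * n ^+ 2 by rewrite expr2 mulrA ltr_pM2r.
(* Otherwise the second bound is at most [(1 - s) ^ 2 n ^ 2 + 2 n], and [(1 - s) ^ 2 = 2 s ^ 2]. *)
have dsn : d < s * n.
  rewrite ltNge; apply/negP => snd.
  have : (n - d) ^+ 2 <= ((1 - s) * n) ^+ 2 by rewrite ler_sqr ?nnegrE; nra.
  have : (1 - s) ^+ 2 = 2 * s ^+ 2 by rewrite sE; lra.
  rewrite exprMn => ->; lra.
have dd : 2 * s ^+ 2 * n <= d by rewrite -(ler_pM2l n0); lra.
(* In the third bound, [(n - d) ^ 2 + 2 d ^ 2 - 4 s ^ 2 n ^ 2] equals
   [- (s n - d) (3 d - (2 - 3 s) n)]. Since [d >= 2 s ^ 2 n = (2 - 4 s) n], the last factor is at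
   least [(4 - 9 s) n], whence the condition [s <= 4 / 9]. *)
have c1 : 0 <= (d - 2 * s ^+ 2 * n) * (s * n - d) by apply: mulr_ge0; lra.
have c2 : 0 <= (4 - 9 * s) * n * (s * n - d).
  by apply: mulr_ge0; [apply: mulr_ge0; lra | lra].
rewrite sE in c1 h3 *.
have s3 : s ^+ 3 = s - 2 * s ^+ 2 by rewrite exprS sE; lra.
have E1 : s * s = 1 - 2 * s by rewrite -expr2.
have E2 : s * s * n * n = (1 - 2 * s) * n * n by rewrite E1.
lra.
Qed.

Lemma Cov_threshold_le (R : realType) (k : nat) (V : finType) (F : kgraph k V)
    (P : {set {set V}}) :
  (3 <= k)%N -> complete_partite F P ->
  threshold R (k - 2) #|V| (Cov F) <=
    if cone F then 0 else 2%:R * (Num.sqrt 2%:R - 1) ^+ 2.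
Proof.
move=> k3 FP; have k0 : (0 < k)%N := ltnW (ltnW k3).
have k2 : (1 < k)%N := ltnW k3.
have s2 : (Num.sqrt 2 : R) ^+ 2 = 2 by rewrite sqr_sqrtr.
have s0 : 0 < (Num.sqrt 2 : R) - 1.
  by rewrite subr_gt0 -[ltLHS]sqrtr1 ltr_sqrt // ltr1n.
have s4 : (Num.sqrt 2 : R) - 1 <= 4 / 9.
  by rewrite lerBlDr -(@ler_sqr R) ?nnegrE ?sqrtr_ge0 ?s2; lra.
have sE : (Num.sqrt 2 - 1 : R) ^+ 2 = 1 - 2 * (Num.sqrt 2 - 1).
  by rewrite sqrrB1 s2; lra.
case: ifP => [coneF|_]; apply: threshold_le; apply: forcing_of_link_pairs => //.
- by rewrite lexx ler01.
- move=> mu mu0; exists k => W G kW _ HS; apply: (Cov_of_cone k3 FP) => //.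
  move=> S Sk; rewrite -(ltr_nat R); apply: lt_le_trans (HS S Sk).
  by rewrite add0r mulr_gt0 // exprn_gt0 // ltr0n (leq_trans k0 kW).
- move: s0 s4 sE; set s := Num.sqrt _ - 1 => s0 s4 sE.
  have : 0 <= (4 / 9 - s) * s by apply: mulr_ge0; lra.
  lra.
move=> mu mu0; have [n1 Hn1] := archi_nat (3 / mu); exists (maxn k n1) => W G.
rewrite geq_max => /andP[kW n1W] _ HS v.
have n0 : 0 < #|W|%:R :> R by rewrite ltr0n (leq_trans k0 kW).
have mun : 2 < mu * #|W|%:R.
  have : 3 / mu <= #|W|%:R by apply: le_trans Hn1 _; rewrite ler_nat.
  by rewrite ler_pdivrMr //; lra.
have [|S vS Sk] := @ex_superset_card W [set v] (k - 2).
  by rewrite cards1 (leq_trans (leq_subr _ _) kW) andbT subn_gt0.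
have vS' : v \in S by rewrite (subsetP vS) ?set11.
have vT : v \notin S :\ v by rewrite !inE eqxx.
have Tk : #|S :\ v|.+3 = k by rewrite -[RHS](subnK k2) -Sk (cardsD1 v S) vS' addn2.
apply: contrapT => ncov.
have [||u [d [uT dn h1 h2 h3]]] := @uncovered_link_bounds k W G v (S :\ v) Tk vT.
(* Two distinct extensions of the same set, one of them by [v], would cover [v]. *)
- move=> a b w vab wab; apply/eqP; rewrite eq_sym; apply: contraT => vw; exfalso.
  apply: ncov; apply: (hom_singleton_of_twins k3 FP vw vab wab).
  by rewrite -Tk; apply: (@card_setU3 _ _ v); rewrite Tk (edges_uniform vab).
- rewrite -(ltr_nat R); apply: lt_le_trans (HS _ _); last by rewrite cardsU1 vT add1n.
  by rewrite mulr_gt0 // ?exprn_gt0 // sE; lra.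
have uk : #|u |: (S :\ v)|.+2 = k by rewrite cardsU1 uT add1n.
have vk : #|v |: (S :\ v)|.+2 = k by rewrite cardsU1 vT add1n.
have hu := HS _ uk; have hv := HS _ vk.
apply: (@cover_arith R (Num.sqrt 2 - 1) mu #|W|%:R d%:R) => //; first by rewrite ler_nat.
- by apply: le_trans hv _; rewrite -natrM ler_nat.
- by apply: le_trans hu _; rewrite -natrB // -natrX -natrM -natrD ler_nat.
rewrite mulr_natl mulr2n; apply: le_trans (lerD hu hv) _.
by rewrite -natrB // -!natrX -!natrM -!natrD ler_nat.
Qed.

Local Close Scope ring_scope.
Unset Implicit Arguments.
Set Strict Implicit.
Set Printing Implicit Defensive.

Theorem theorem4p7 (R : realType) (k : nat) (V : finType) (F : kgraph k V)
    (P : {set {set V}}) (A B : {set V}) (tau1 tau2 : R) :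
  3 <= k ->
  complete_partite F P ->
  gcdF F = Some 1 ->
  two_smallest_parts P A B ->
  tau1 = rel_size R A ->
  tau2 = rel_size R B ->
  [/\ threshold R (k - 2) #|V| (Spa R F) =
        Num.max (1 - (1 - tau1) ^+ 2)%R ((tau1 + tau2) ^+ 2)%R,
      threshold R (k - 2) #|V| (Div R F) =
        (if (k == 3)%N then 4%:R^-1 else 0)%R &
      (threshold R (k - 2) #|V| (Cov F) <=
        if cone F then 0 else 2%:R * (Num.sqrt 2%:R - 1) ^+ 2)%R].
Proof.
move=> k3 FP gF ABP -> ->; split.
- exact: Spa_threshold k3 FP ABP.
- exact: Div_threshold k3 FP gF.
- exact: Cov_threshold_le k3 FP.
Qed.
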